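(* Let $\Delta$ be a Delzant polytope in $\mathfrak t^*=(\mathbb R^n)^*$ with $m$ facets, and put $r:=m-n$. If all the points $\dot{\mathrm{Cm}}(\Delta(k))$, for $k\in\mathcal C_\Delta$, belong to one hyperplane of $(\mathbb R^n)^*$ having a (nonzero) conormal vector in $\mathbb Z^n$, and $r\le 2$, then $\Delta$ admits a mass linear function, i.e. there is a nonzero $\mathbf b\in\mathfrak t$ such that $(\Delta,\mathbf b)$ is a mass linear pair.
   Context: $T=(U(1))^n$, with Lie algebra $\mathfrak t\cong\mathbb R^n$ whose integer lattice is $\mathbb Z^n$. For $\mathbf n=(\mathbf n_1,\dots,\mathbf n_m)$ with $\mathbf n_j\in\mathfrak t$, and $k\in\mathbb R^m$, let $\Delta(\mathbf n,k)=\bigcap_{j=1}^m\{x\in\mathfrak t^*:\langle x,\mathbf n_j\rangle\le k_j\}$, a polytope with $m$ facets $F_j$ (contained in $\langle x,\mathbf n_j\rangle=k_j$) and outward conormals $\mathbf n_j$. It is Delzant if exactly $n$ facets meet at each vertex and the conormals are primitive integral vectors such that those of the facets meeting at any vertex form a $\mathbb Z$-basis of the integer lattice. The chamber $\mathcal C_\Delta$ of a polytope $\Delta=\Delta(\mathbf n,k^0)$ is the set of $k'\in\mathbb R^m$ such that $\Delta(\mathbf n,k')$, with facets $F'_j$, is analogous to $\Delta$: for every $J\subset\{1,\dots,m\}$, $\bigcap_{j\in J}F_j\neq\emptyset$ iff $\bigcap_{j\in J}F'_j\ne\emptyset$. For $k\in\mathcal C_\Delta$ write $\Delta(k)=\Delta(\mathbf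 n,k)$, and $\mathrm{Cm}(\Delta(k))$ for its center of mass. The pair $(\Delta,\mathbf b)$ is mass linear if there are constants $R_j,C\in\mathbb R$ with $\langle\mathrm{Cm}(\Delta(k)),\mathbf b\rangle=\sum_jR_jk_j+C$ for all $k\in\mathcal C_\Delta$. For $k\in\mathcal C_\Delta$, $\dot{\mathrm{Cm}}(\Delta(k)):=\frac{d}{d\epsilon}\big|_{\epsilon=0}\mathrm{Cm}(\Delta(k+\check\epsilon))$, where $\check\epsilon=(\epsilon,\dots,\epsilon)\in\mathbb R^m$. A hyperplane of $(\mathbb R^n)^*$ with conormal vector $\mathbf b$ is a set of the form $\{x:\langle x,\mathbf b\rangle=\kappa\}$ with $\kappa\in\mathbb R$. *)

(* Defs.v *)
From HB Require Import structures.
From mathcomp Require Import all_boot all_order all_algebra.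
From mathcomp Require Import all_classical all_reals all_analysis.
Set Implicit Arguments.
Unset Strict Implicit.
Unset Printing Implicit Defensive.
Import Order.TTheory GRing.Theory Num.Theory.
Import numFieldNormedType.Exports.
Local Open Scope classical_set_scope.
Local Open Scope ring_scope.

Section lebesgue_tuple.
Context {R : realType}.
Local Notation T := (measurableTypeR R).
Local Open Scope ereal_scope.

(* n-dimensional Lebesgue measure, on the product sigma-algebra of n-tuples:
   the n-fold product of the one-dimensional one.  For n = 0 it is the unit
   mass at the empty tuple. *)
Fixpoint lebesgue_tuple n : set (n.-tuple T) -> \bar R :=
  match n with
  | 0 => \d_ [tuple]
  | n'.+1 => pushforward (lebesgue_measure \x @lebesgue_tuple n')
               (fun p => [tuple of p.1 :: p.2])
  end.

Let measurable_cons_pair n :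
  measurable_fun setT (fun p : T * n.-tuple T => [tuple of p.1 :: p.2]).
Proof. exact: measurable_cons. Qed.

Let sigma_finite_cons n (m : {sigma_finite_measure set (n.-tuple T) -> \bar R}) :
  sigma_finite setT (pushforward (@lebesgue_measure R \x m)
    (fun p => [tuple of p.1 :: p.2])).
Proof.
have /sigma_finiteP[F [FT ndF Foo]] := sigma_finiteT (@lebesgue_measure R).
have /sigma_finiteP[G [GT ndG Goo]] := sigma_finiteT m.
pose H i := (@tnth n.+1 T ^~ ord0) @^-1` F i `&`
  (fun x : n.+1.-tuple T => [tuple of behead x]) @^-1` G i.
have HE i : (fun p : T * n.-tuple T => [tuple of p.1 :: p.2]) @^-1` H i =
    F i `*` G i.
  have bE (p : T * n.-tuple T) : [tuple of behead [tuple of p.1 :: p.2]] = p.2.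
    exact/val_inj.
  by apply/seteqP; split=> p; rewrite /H /= bE.
exists H.
  apply/esym; rewrite -subTset => t _.
  have : [set: T] (tnth t ord0) by [].
  rewrite FT => -[i _ Fi].
  have : [set: n.-tuple T] [tuple of behead t] by [].
  rewrite GT => -[j _ Gj].
  exists (maxn i j) => //; split => /=.
    by have /subsetPset := ndF _ _ (leq_maxl i j); apply.
  by have /subsetPset := ndG _ _ (leq_maxr i j); apply.
move=> i; split.
  apply: measurableI.
    have := @measurable_tnth _ T n.+1 ord0 measurableT (F i) (Foo i).1.
    by rewrite setTI.
  have := @measurable_behead _ T n measurableT (G i) (Goo i).1.
  by rewrite setTI.
rewrite /pushforward HE product_measure1E ?(Foo i).1 ?(Goo i).1//.
  by apply: lte_mul_pinfty => //; [rewrite ge0_fin_numE// (Foo i).2 | exact: (Goo i).2].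
- exact: (Foo i).1.
- exact: (Goo i).1.
Qed.

Section cons_measure.
Variables (n : nat) (m : {sigma_finite_measure set (n.-tuple T) -> \bar R}).

Definition cons_measure : set (n.+1.-tuple T) -> \bar R :=
  pushforward (@lebesgue_measure R \x m) (fun p => [tuple of p.1 :: p.2]).

Let cons_measure_measure : {measure set (n.+1.-tuple T) -> \bar R} :=
  measure_function_pushforward__canonical__measure_function_Measure
    (@lebesgue_measure R \x m) (@measurable_cons_pair n).

HB.instance Definition _ := isMeasure.Build _ _ _ cons_measure
  (measure0 cons_measure_measure) (measure_ge0 cons_measure_measure)
  (measure_semi_sigma_additive (s := cons_measure_measure)).

HB.instance Definition _ := Measure_isSigmaFinite.Build _ _ _ cons_measure
  (sigma_finite_cons m).

End cons_measure.

Let lebesgue_tuple_measure n :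
  exists m : {sigma_finite_measure set (n.-tuple T) -> \bar R},
    m = @lebesgue_tuple n :> (set (n.-tuple T) -> \bar R).
Proof.
elim: n => [|n [m mE]]; first by exists (\d_ [tuple]).
by exists (cons_measure m); rewrite /= /cons_measure mE.
Qed.

Let lebesgue_tuple0 n : @lebesgue_tuple n set0 = 0.
Proof. by have [m <-] := lebesgue_tuple_measure n. Qed.

Let lebesgue_tuple_ge0 n A : 0 <= @lebesgue_tuple n A.
Proof. by have [m <-] := lebesgue_tuple_measure n. Qed.

Let lebesgue_tuple_sigma_additive n : semi_sigma_additive (@lebesgue_tuple n).
Proof.
have [m <-] := lebesgue_tuple_measure n; exact: measure_semi_sigma_additive.
Qed.

Let lebesgue_tuple_sigma_finite n : sigma_finite setT (@lebesgue_tuple n).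
Proof. have [m <-] := lebesgue_tuple_measure n; exact: sigma_finiteT. Qed.

HB.instance Definition _ n := isMeasure.Build _ _ _ (@lebesgue_tuple n)
  (@lebesgue_tuple0 n) (@lebesgue_tuple_ge0 n)
  (@lebesgue_tuple_sigma_additive n).

HB.instance Definition _ n := Measure_isSigmaFinite.Build _ _ _
  (@lebesgue_tuple n) (@lebesgue_tuple_sigma_finite n).

End lebesgue_tuple.

Section convex_geometry.
Context {R : realType} {n : nat}.

(* Elements of t^* are rows, elements of t are columns. *)
Definition pairing (x : 'rV[R]_n) (v : 'cV[R]_n) : R := (x *m v) 0 0.

Definition hyperplane (v : 'cV[R]_n) (kappa : R) : set 'rV[R]_n :=
  [set x | pairing x v = kappa].

(* The affine hull of A has dimension d: A contains d + 1 affinely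
   independent points, namely p and the p + row i M, but not d + 2. *)
Definition has_dim (A : set 'rV[R]_n) (d : nat) : Prop :=
  (exists (p : 'rV[R]_n) (M : 'M[R]_(d, n)),
      [/\ A p, forall i, A (p + row i M) & row_free M]) /\
  (forall (p : 'rV[R]_n) (M : 'M[R]_(d.+1, n)),
      A p -> (forall i, A (p + row i M)) -> ~~ row_free M).

Definition is_vertex (A : set 'rV[R]_n) (x : 'rV[R]_n) : Prop :=
  A x /\ forall (y z : 'rV[R]_n) (t : R), A y -> A z -> 0 < t < 1 ->
    x = t *: y + (1 - t) *: z -> y = x /\ z = x.

Definition center_of_mass (A : set 'rV[R]_n) : 'rV[R]_n :=
  let mu := @lebesgue_tuple R n in
  let A' := [set t : n.-tuple (measurableTypeR R) | A (\row_i tnth t i)] in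
  \row_i (\int[mu]_(t in A') tnth t i / fine (mu A')).

Definition integral_vec (v : 'cV[R]_n) : Prop := v \is a mxOver Num.int.

(* A primitive vector is nonzero, as 0 is the multiple 0 *~ 0. *)
Definition primitive_vec (v : 'cV[R]_n) : Prop :=
  integral_vec v /\
  forall (w : 'cV[R]_n) (d : int), integral_vec w -> v = w *~ d -> `|d| = 1.

End convex_geometry.

Section polytopes.
Context {R : realType} {n m : nat}.
Implicit Types (N : 'I_m -> 'cV[R]_n) (k : 'rV[R]_m) (J : {set 'I_m}).

(* The family (N j)_(j in J) is a Z-basis of the integer lattice. *)
Definition lattice_basis N J : Prop :=
  (forall j, j \in J -> integral_vec (N j)) /\
  forall w : 'cV[R]_n, integral_vec w ->
    exists! c : {ffun 'I_m -> int},
      (forall j, j \notin J -> c j = 0) /\ w = \sum_(j in J) N j *~ c j.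

Definition polyhedron N k : set 'rV[R]_n :=
  [set x | forall j, pairing x (N j) <= k 0 j].

Definition facet N k (j : 'I_m) : set 'rV[R]_n :=
  polyhedron N k `&` hyperplane (N j) (k 0 j).

(* A full-dimensional polytope with exactly m facets, the sets [facet N k j];
   the N j are then outward conormals. *)
Definition polytope_with_facets N k : Prop :=
  [/\ bounded_set (polyhedron N k),
      has_dim (polyhedron N k) n,
      forall j, exists2 d, n = d.+1 & has_dim (facet N k j) d
    & injective (facet N k)].

Definition facets_at N k (x : 'rV[R]_n) : {set 'I_m} :=
  [set j | `[< facet N k j x >]]%SET.

Definition delzant N k : Prop :=
  [/\ polytope_with_facets N k,
      forall j, primitive_vec (N j)
    & forall x, is_vertex (polyhedron N k) x ->
        #|facets_at N k x| = n /\ lattice_basis N (facets_at N k x)].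

(* For k' in the chamber of a Delzant polytope the sets [facet N k' j] are
   automatically facets: the equivalence makes every vertex of
   [polyhedron N k'] simple and every [facet N k' j] nonempty. *)
Definition analogous N k k' : Prop :=
  forall J, \bigcap_(j in [set` J]) facet N k j !=set0 <->
            \bigcap_(j in [set` J]) facet N k' j !=set0.

Definition chamber N k0 : set 'rV[R]_m := [set k | analogous N k0 k].

Definition Cm N k : 'rV[R]_n := center_of_mass (polyhedron N k).

Definition Cm_dot N k : 'rV[R]_n :=
  (fun eps : R => Cm N (k + const_mx eps))^`()%classic 0.

Definition mass_linear N k0 (b : 'cV[R]_n) : Prop :=
  exists (r : 'I_m -> R) (C : R), forall k, chamber N k0 k ->
    pairing (Cm N k) b = (\sum_j r j * k 0 j) + C.

End polytopes.

(* Main.v *)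
Require Import Defs.
From mathcomp Require Import all_boot all_order all_algebra.
From mathcomp Require Import all_classical all_reals all_analysis.
From mathcomp Require Import measurable_realfun ring lra.
Set Implicit Arguments.
Unset Strict Implicit.
Unset Printing Implicit Defensive.
Import Order.TTheory GRing.Theory Num.Theory.
Import numFieldNormedType.Exports.
Local Open Scope classical_set_scope.
Local Open Scope ring_scope.

(** Let [f k] be the pairing of the center of mass of [Delta(k)] with the given
    conormal [c]. It is homogeneous of degree 1, it satisfies
    [f (k + (<v, n_j>)_j) = f k + <v, c>], and the hypothesis says that its
    derivative along [e = (1, ..., 1)] is constant. Subtracting a linear form
    that behaves like [f] on the translations and on [e] leaves a homogeneous
    function [g] that is constant along the space [W] spanned by the
    translations and [e]. As the polytope is bounded, [W] has dimension
    [n + 1 >= m - 1], so that [g] factors through a line, with one slope on each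
    half-line. If the chamber, which is convex, meets both sides of [W], it meets
    [W], where the differentiability of [g] forces the two slopes to agree. Thus
    [b = c] works.

    Differentiability of volumes: after a shear no conormal has a zero first
    coordinate, and by Fubini the volume is an integral of lengths of segments;
    these are Lipschitz in the parameter, and affine near it for almost every
    section, so that dominated convergence applies. First moments are volumes of
    regions under graphs of coordinates. *)

(** * Lebesgue measure on tuples *)

Section lebesgue_tuple_theory.
Context {R : realType}.
Local Notation T := (measurableTypeR R).
Local Notation mu n := (@lebesgue_tuple R n).

Definition consT n (x : T) (t : n.-tuple T) : n.+1.-tuple T := [tuple of x :: t].

Lemma tnth_cons0 n x (t : n.-tuple T) : tnth (consT x t) ord0 = x.
Proof. exact: tnth0. Qed.

Lemma tnth_consS n x (t : n.-tuple T) i : tnth (consT x t) (lift ord0 i) = tnth t i.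
Proof. exact: tnthS. Qed.

(** Rescaled by [s], the pushforward measure agrees with Lebesgue measure on half-open intervals,
    and uniqueness extends this to all measurable sets. *)
Lemma lebesgue_measure_affine (s v : R) (A : set T) : 0 < s -> measurable A ->
  lebesgue_measure ((fun x : T => s * x + v) @^-1` A) =
  ((s^-1)%:E * lebesgue_measure A)%E.
Proof.
move=> s0 mA.
have mphi : measurable_fun setT (fun x : T => s * x + v : T).
  apply: measurable_funD => //; exact: measurable_funM.
pose m' := measure_function_pushforward__canonical__measure_function_Measure
    (@lebesgue_measure R) mphi.
have s0' : 0 <= s by exact: ltW.
have -> : lebesgue_measure A = mscale (NngNum s0') m' A.
  apply: lebesgue_measure_unique => //= X [[a b] _ <-].
  rewrite /mscale/= /pushforward.
  have -> : (fun x : T => s * x + v) @^-1` [set` `]a, b]] =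
            [set` `](a - v) / s, (b - v) / s]].
    apply/seteqP; split=> x /=; rewrite !in_itv/= ltr_pdivrMr// ler_pdivlMr//;
    rewrite ltrBlDr lerBrDr mulrC //.
  rewrite !lebesgue_measure_itv/= !lte_fin ltr_pM2r ?invr_gt0// ltrD2r.
  case: ifP => _; last by rewrite mule0.
  by rewrite -!EFinD -EFinM; congr EFin; field; rewrite gt_eqF.
by rewrite /mscale/= muleA -EFinM mulVf ?gt_eqF// mul1e.
Qed.

Lemma measurable_consP n : measurable_fun setT
  (fun p : T * n.-tuple T => consT p.1 p.2).
Proof. exact: measurable_cons. Qed.

Lemma measurable_cons_pre n (A : set (n.+1.-tuple T)) : measurable A ->
  measurable ((fun p : T * n.-tuple T => consT p.1 p.2) @^-1` A).
Proof. by move=> mA; rewrite -[X in measurable X]setTI; exact: measurable_consP. Qed.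

Lemma measurable_consl n (A : set (n.+1.-tuple T)) (x : T) : measurable A ->
  measurable [set t : n.-tuple T | A (consT x t)].
Proof.
move=> mA; have := measurable_xsection x (measurable_cons_pre mA).
by congr measurable; apply/seteqP; split=> t /=; rewrite /xsection/= inE.
Qed.

Lemma lebesgue_tupleE1 n (A : set (n.+1.-tuple T)) :
  mu n.+1 A = (\int[lebesgue_measure]_x mu n [set t | A (consT x t)])%E.
Proof.
rewrite /= /pushforward /product_measure1; apply: eq_integral => x _ /=.
by congr lebesgue_tuple; apply/seteqP; split=> t /=; rewrite /xsection/= inE.
Qed.

(** Iterating in the other order gives rectangles the same measure, so uniqueness of the product
    measure applies. In this form a volume is an integral of lengths of sections parallel to the
    first axis. *)
Lemma lebesgue_tupleE2 n (A : set (n.+1.-tuple T)) : measurable A ->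
  mu n.+1 A = (\int[mu n]_t lebesgue_measure [set x | A (consT x t)])%E.
Proof.
move=> mA; rewrite /= /pushforward.
rewrite (@product_measure_unique _ _ _ _ _ _ _
  (lebesgue_measure \x^ mu n)%E) //; first last.
- exact: measurable_cons_pre.
- by move=> X Y mX mY; exact: product_measure2E.
rewrite /= /product_measure2; apply: eq_integral => t _ /=.
by congr lebesgue_measure; apply/seteqP; split=> x /=; rewrite /ysection/= inE.
Qed.

Lemma measurable_tuple_section1 n (A : set (n.+1.-tuple T)) : measurable A ->
  measurable_fun setT (fun x : T => mu n [set t | A (consT x t)]).
Proof.
move=> mA; have := measurable_fun_xsection (mu n) (measurable_cons_pre mA).
by congr measurable_fun; apply/funext => x /=; congr lebesgue_tuple;
  apply/seteqP; split=> t /=; rewrite /xsection/= inE.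
Qed.

Lemma measurable_tuple_section2 n (A : set (n.+1.-tuple T)) : measurable A ->
  measurable_fun setT (fun t => lebesgue_measure [set x : T | A (consT x t)]).
Proof.
move=> mA; have := measurable_fun_ysection lebesgue_measure (measurable_cons_pre mA).
by congr measurable_fun; apply/funext => t /=; congr lebesgue_measure;
  apply/seteqP; split=> x /=; rewrite /ysection/= inE.
Qed.

Definition affT n (s : R) (v : 'I_n -> R) (t : n.-tuple T) : n.-tuple T :=
  [tuple (s * tnth t i + v i : T) | i < n].

Lemma affT_cons n (s : R) (v : 'I_n.+1 -> R) x (t : n.-tuple T) :
  affT s v (consT x t) = consT (s * x + v ord0) (affT s (v \o lift ord0) t).
Proof.
apply: eq_from_tnth => i; rewrite tnth_mktuple.
case: (unliftP ord0 i) => [j|] ->; last by rewrite !tnth_cons0.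
by rewrite !tnth_consS tnth_mktuple.
Qed.

(** Induction on [n]: each slice is handled by the induction hypothesis, and the remaining integral
    over the first coordinate by the one-dimensional change of variables. *)
Lemma lebesgue_tuple_affine n (s : R) (v : 'I_n -> R) (A : set (n.-tuple T)) :
  0 < s -> measurable A ->
  mu n (affT s v @^-1` A) = ((s^-1 ^+ n)%:E * mu n A)%E.
Proof.
move=> s0; elim: n v A => [|n IH] v A mA.
  rewrite expr0 mul1e; congr lebesgue_tuple; have affE t : affT s v t = t by rewrite [LHS]tuple0 [RHS]tuple0.
  by apply/seteqP; split=> t /=; rewrite affE.
rewrite !lebesgue_tupleE1.
have si0 : 0 <= s^-1 ^+ n by rewrite exprn_ge0// invr_ge0 ltW.
pose G (x : T) := ((s^-1 ^+ n)%:E * mu n [set t | A (consT x t)])%E.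
have mG : measurable_fun setT G.
  by apply: measurable_funeM; exact: measurable_tuple_section1.
have G0 x : (0 <= G x)%E by apply: mule_ge0 => //; rewrite lee_fin.
transitivity (\int[lebesgue_measure]_x G (s * x + v ord0)%R)%E.
  apply: eq_integral => x _; rewrite /G -(IH (v \o lift ord0)).
    by congr lebesgue_tuple; apply/seteqP; split=> t /=; rewrite affT_cons.
  exact: measurable_consl.
have mphi : measurable_fun setT (fun x : T => s * x + v ord0 : T).
  apply: measurable_funD => //; exact: measurable_funM.
have := ge0_integral_pushforward mphi lebesgue_measure measurableT mG
  (fun y _ => G0 y).
rewrite preimage_setT => /esym; rewrite {1}/comp => ->.
have si0' : 0 <= s^-1 by rewrite invr_ge0 ltW.
transitivity (\int[mscale (NngNum si0') lebesgue_measure]_x G x)%E.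
  by apply: eq_measure_integral => B mB _ /=; rewrite /mscale/= /pushforward
    lebesgue_measure_affine.
rewrite ge0_integral_mscale//= /G ge0_integralZl//.
- by rewrite muleA -EFinM exprS.
- exact: measurable_tuple_section1.
Qed.

End lebesgue_tuple_theory.

(** * Hyperplanes, cubes, shears and polyhedra in tuple space *)

Section tuple_polyhedra.
Context {R : realType}.
Local Notation T := (measurableTypeR R).
Local Notation mu n := (@lebesgue_tuple R n).

Definition dot n (q : 'I_n -> R) (t : n.-tuple T) : R := \sum_i q i * tnth t i.

Lemma dot_cons n (q : 'I_n.+1 -> R) x (t : n.-tuple T) :
  dot q (consT x t) = q ord0 * x + dot (q \o lift ord0) t.
Proof.
rewrite /dot big_ord_recl tnth_cons0; congr (_ + _).
by apply: eq_bigr => i _; rewrite tnth_consS.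
Qed.

Lemma measurable_dot n (q : 'I_n -> R) : measurable_fun setT (dot q).
Proof.
apply: measurable_sum => i; apply: measurable_funM => //; exact: measurable_tnth.
Qed.

Lemma measurable_dot_eq n (q : 'I_n -> R) (c : R) :
  measurable [set t | dot q t = c].
Proof.
rewrite (_ : mkset _ = dot q @^-1` [set c]) //.
by rewrite -[X in measurable X]setTI; apply: measurable_dot.
Qed.

(** When [q ord0] vanishes, every slice at a fixed first coordinate is a hyperplane in one dimension
    less; otherwise every line parallel to the first axis meets the set in one point. *)
Lemma hyperplane_null n (q : 'I_n -> R) (c : R) :
  (exists i, q i != 0) -> mu n [set t | dot q t = c] = 0%E.
Proof.
elim: n q c => [|n IH] q c [i qi]; first by case: i qi.
have [q0|q0] := eqVneq (q ord0) 0.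
  rewrite lebesgue_tupleE1; apply: integral0_eq => x _.
  transitivity (mu n [set t | dot (q \o lift ord0) t = c]).
    by congr lebesgue_tuple; apply/seteqP; split=> t /=;
      rewrite dot_cons q0 mul0r add0r.
  apply: IH; move: qi; case: (unliftP ord0 i) => [j ->|->]; last by rewrite q0 eqxx.
  by exists j.
rewrite lebesgue_tupleE2; last exact: measurable_dot_eq.
apply: integral0_eq => t _.
rewrite (_ : mkset _ = [set (c - dot (q \o lift ord0) t) / q ord0]).
  exact: lebesgue_measure_set1.
apply/seteqP; split=> x /=; rewrite dot_cons.
  by move=> <-; rewrite addrK mulrC mulKf.
by move=> ->; rewrite mulrC divfK// subrK.
Qed.

Definition tuple_box n (x : 'I_n -> R) (d : R) : set (n.-tuple T) :=
  [set t | forall i, `|tnth t i - x i| <= d].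

Lemma measurable_tuple_box n (x : 'I_n -> R) d : measurable (tuple_box x d).
Proof.
rewrite (_ : tuple_box x d = \bigcap_(i in [set: 'I_n])
   ((@tnth _ T ^~ i) @^-1` `[x i - d, x i + d]%classic)).
  apply: fin_bigcap_measurable => // i _.
  by rewrite -[X in measurable X]setTI; apply: measurable_tnth.
by apply/seteqP; split=> t /= h i => [_|]; move: (h i) => /=;
  rewrite in_itv/= ler_distl// => /(_ Logic.I).
Qed.

Lemma lebesgue_tuple_box n (x : 'I_n -> R) d : 0 <= d ->
  mu n (tuple_box x d) = ((d *+ 2) ^+ n)%:E.
Proof.
move=> d0; elim: n x => [|n IH] x.
  by rewrite expr0 /= diracE mem_set// => -[].
rewrite exprS EFinM -(IH (x \o lift ord0)) /= /pushforward.
have -> : (d *+ 2)%:E = @lebesgue_measure R `[x ord0 - d, x ord0 + d].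
  rewrite lebesgue_measure_itv/= lte_fin; case: ltP => h.
    by rewrite -EFinD; congr EFin; ring.
  by have -> : d = 0; [lra|rewrite mul0rn].
rewrite -product_measure1E//; last exact: measurable_tuple_box.
congr (_ \x _)%E; apply/seteqP; split=> -[y t]/=.
  move=> h; split => [|i /=].
    by have := h ord0; rewrite tnth_cons0 in_itv/= ler_distl.
  by have := h (lift ord0 i); rewrite tnth_consS.
move=> [h1 h2] i; case: (unliftP ord0 i) => [j ->|->].
  by rewrite tnth_consS; exact: h2.
by rewrite tnth_cons0; move: h1; rewrite in_itv/= ler_distl.
Qed.

Definition shearT n (w : 'I_n -> R) (t : n.+1.-tuple T) : n.+1.-tuple T :=
  consT (thead t) (affT 1 (fun i => w i * thead t) [tuple of behead t]).

Lemma shearT_cons n (w : 'I_n -> R) x (t : n.-tuple T) :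
  shearT w (consT x t) = consT x (affT 1 (fun i => w i * x) t).
Proof.
rewrite /shearT; have -> : thead (consT x t) = x by rewrite /thead tnth_cons0.
by congr (consT _ (affT _ _ _)); apply/val_inj.
Qed.

(** On each slice with fixed first coordinate the shear is a translation. *)
Lemma lebesgue_tuple_shear n (w : 'I_n -> R) (A : set (n.+1.-tuple T)) :
  measurable A -> mu n.+1 (shearT w @^-1` A) = mu n.+1 A.
Proof.
move=> mA; rewrite !lebesgue_tupleE1; apply: eq_integral => x _.
transitivity (mu n (affT 1 (fun i => w i * x) @^-1` [set t | A (consT x t)])).
  by congr lebesgue_tuple; apply/seteqP; split=> t /=; rewrite shearT_cons.
rewrite lebesgue_tuple_affine//; last exact: measurable_consl.
by rewrite invr1 expr1n mul1e.
Qed.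

(** The index type is any finite type, so that the regions under graphs, which have two more
    constraints, are of the same form. *)
Definition hpoly (I : finType) n (a : I -> 'I_n -> R) (k : I -> R) :
    set (n.-tuple T) :=
  [set t | forall j, dot (a j) t <= k j].

Lemma measurable_hpoly (I : finType) n (a : I -> 'I_n -> R) (k : I -> R) :
  measurable (hpoly a k).
Proof.
rewrite (_ : hpoly a k = \bigcap_(j in [set: I])
   (dot (a j) @^-1` `]-oo, k j]%classic)).
  apply: fin_bigcap_measurable => // i _.
  by rewrite -[X in measurable X]setTI; apply: measurable_dot.
by apply/seteqP; split=> t /= h i => [_|]; move: (h i) => /=;
  rewrite in_itv/= // => /(_ Logic.I).
Qed.

Lemma lebesgue_tuple_bounded_fin n (A : set (n.-tuple T)) (B : R) :
  measurable A -> (forall t, A t -> forall i, `|tnth t i| <= B) ->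
  mu n A \is a fin_num.
Proof.
move=> mA AB; rewrite ge0_fin_numE//.
have B0 : 0 <= Num.max B 0 by rewrite le_max lexx orbT.
apply: (@le_lt_trans _ _ (mu n (tuple_box (fun=> 0) (Num.max B 0)))).
  apply: le_measure; rewrite ?inE//; first exact: measurable_tuple_box.
  by move=> t At i; rewrite subr0 le_max (AB t).
by rewrite lebesgue_tuple_box// ltry.
Qed.

End tuple_polyhedra.

(** * Differentiability of volumes and centers of mass *)

Section segments.
Context {R : realType} {I : finType} (J : pred I).
Implicit Types q : I -> R.
Local Notation T := (measurableTypeR R).

(** The shape of the section of a polyhedron by a line: the indices in [J] bound it from above, the
    others from below. *)
Definition seg (q : I -> R) : set T :=
  [set x | forall i, if J i then x <= q i else q i <= x].

Definition seglen (q : I -> R) : R := fine (lebesgue_measure (seg q)).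

Lemma lebesgue_seg q jU jL : J jU -> ~~ J jL ->
  (forall i, J i -> q jU <= q i) -> (forall i, ~~ J i -> q i <= q jL) ->
  lebesgue_measure (seg q) = (Num.max 0 (q jU - q jL))%:E.
Proof.
move=> JU JL hU hL.
have -> : seg q = [set` `[q jL, q jU]].
  apply/seteqP; split=> x /=; rewrite in_itv/=.
    by move=> h; have := h jU; have := h jL; rewrite (negbTE JL) JU => -> ->.
  move=> /andP[h1 h2] i; case: ifPn => Ji; first exact: le_trans (hU _ Ji).
  exact: le_trans (hL _ Ji) _.
rewrite lebesgue_measure_itv/= lte_fin; case: ifP => h.
  by rewrite -EFinD max_r// subr_ge0 ltW.
by rewrite max_l// subr_le0 leNgt h.
Qed.

Hypothesis J1 : exists j, J j.
Hypothesis J0 : exists j, ~~ J j.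

Lemma seg_extrema (q : I -> R) : exists jU jL, [/\ J jU, ~~ J jL,
  (forall i, J i -> q jU <= q i) & (forall i, ~~ J i -> q i <= q jL)].
Proof.
have [j1 Jj1] := J1; have [j0 Jj0] := J0.
exists [arg min_(i < j1 | J i) q i]%O, [arg max_(i > j0 | ~~ J i) q i]%O.
case: (@arg_minP _ _ _ j1 J q Jj1) => jU JU hU.
by case: (@arg_maxP _ _ _ j0 (fun i => ~~ J i) q Jj0) => jL JL hL; split.
Qed.

Lemma lebesgue_segE q : lebesgue_measure (seg q) = (seglen q)%:E.
Proof.
have [jU [jL [JU JL hU hL]]] := seg_extrema q.
by rewrite /seglen (lebesgue_seg JU JL hU hL).
Qed.

Lemma seglenE q jU jL : J jU -> ~~ J jL ->
  (forall i, J i -> q jU <= q i) -> (forall i, ~~ J i -> q i <= q jL) ->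
  seglen q = Num.max 0 (q jU - q jL).
Proof. by move=> JU JL hU hL; rewrite /seglen (lebesgue_seg JU JL hU hL). Qed.

(** The smallest upper endpoint and the largest lower endpoint each move by at most [D], and cutting
    off at 0 does not increase distances. *)
Lemma seglen_le_lipschitz q q' D : (forall i, `|q i - q' i| <= D) ->
  seglen q <= seglen q' + D *+ 2.
Proof.
move=> qq'; have [jU [jL [JU JL hU hL]]] := seg_extrema q.
have [jU' [jL' [JU' JL' hU' hL']]] := seg_extrema q'.
rewrite (seglenE JU JL hU hL) (seglenE JU' JL' hU' hL').
have D0 : 0 <= D by exact: le_trans (qq' jU).
have := hU _ JU'; have := hL _ JL'.
have := qq' jU'; have := qq' jL'; rewrite !ler_distl => /andP[? ?] /andP[? ?] ? ?.
rewrite ge_max; apply/andP; split.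
  by rewrite addr_ge0 ?mulrn_wge0// le_max lexx.
have : q' jU' - q' jL' <= Num.max 0 (q' jU' - q' jL').
  by rewrite le_max lexx orbT.
rewrite mulr2n; lra.
Qed.

Lemma seglen_lipschitz q q' D : (forall i, `|q i - q' i| <= D) ->
  `|seglen q - seglen q'| <= D *+ 2.
Proof.
move=> qq'; rewrite ler_distl; apply/andP; split; last exact: seglen_le_lipschitz.
rewrite lerBlDr; apply: seglen_le_lipschitz => i; by rewrite distrC.
Qed.

(** By injectivity the smallest upper endpoint and the largest lower one are each attained at a
    single index, which stays optimal for small [ep]. These two endpoints also differ, so the sign
    of their difference is fixed near 0 and the cut-off at 0 creates no kink. *)
Lemma seglen_locally_affine (u e : I -> R) : injective u ->
  exists l, \forall ep \near (0 : R),
    seglen (fun i => u i + ep * e i) = seglen u + ep * l.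
Proof.
move=> uI; have [jU [jL [JU JL hU hL]]] := seg_extrema u.
have near_lt (i j : I) : u i < u j ->
    \forall ep \near (0 : R), u i + ep * e i < u j + ep * e j.
  move=> uij.
  have c : (fun ep : R => (u j + ep * e j) - (u i + ep * e i)) @ 0 -->
     (u j + 0 * e j) - (u i + 0 * e i).
    apply: cvgB; (apply: cvgD; [exact: cvg_cst|apply: cvgMr_tmp; exact: cvg_id]).
  near=> ep; rewrite -subr_gt0; near: ep.
  apply: (cvgr_gt _ c); by rewrite !mul0r !addr0 subr_gt0.
have FF : Filter (nbhs (0 : R)) by typeclasses eauto.
have nU : \forall ep \near (0 : R), forall i, J i ->
    u jU + ep * e jU <= u i + ep * e i.
  have h := @filter_forall R I (fun i => [set ep | J i ->
    u jU + ep * e jU <= u i + ep * e i]) (nbhs (0 : R)) FF.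
  apply: h => i.
  have [Ji|nJi] := boolP (J i); last by apply: nearW.
  have [->|iU] := eqVneq i jU; first by apply: nearW => ep _; exact: lexx.
  have : u jU < u i by rewrite lt_neqAle hU// andbT (inj_eq uI) eq_sym.
  by move=> /near_lt; apply: filterS => ep /ltW ? _.
have nL : \forall ep \near (0 : R), forall i, ~~ J i ->
    u i + ep * e i <= u jL + ep * e jL.
  have h := @filter_forall R I (fun i => [set ep | ~~ J i ->
    u i + ep * e i <= u jL + ep * e jL]) (nbhs (0 : R)) FF.
  apply: h => i.
  have [Ji|nJi] := boolP (J i); first by apply: nearW.
  have [->|iL] := eqVneq i jL; first by apply: nearW => ep _; exact: lexx.
  have : u i < u jL by rewrite lt_neqAle hL// andbT (inj_eq uI).
  by move=> /near_lt; apply: filterS => ep /ltW ? _.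
have UL : jU != jL by apply: contraNneq JL => <-.
rewrite (seglenE JU JL hU hL).
have [lt|gt|/uI eqUL] := ltgtP (u jU) (u jL); last by rewrite eqUL eqxx in UL.
- exists 0; have := near_lt _ _ lt; move: nL; move: nU.
  apply: filterS3 => ep h1 h2 h3; rewrite (seglenE JU JL h1 h2).
  by rewrite !max_l ?mulr0 ?addr0// subr_le0 ltW.
- exists (e jU - e jL); have := near_lt _ _ gt; move: nL; move: nU.
  apply: filterS3 => ep h1 h2 h3; rewrite (seglenE JU JL h1 h2).
  rewrite !max_r ?subr_ge0; [ring|exact: ltW|exact: ltW].
Unshelve. all: by end_near. Qed.

End segments.

(** * Derivative of the volume when no conormal has a zero first entry *)

Section volume_derivable_transverse.
Context {R : realType} {n : nat} {I : finType}.
Local Notation T := (measurableTypeR R).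
Local Notation mu n := (@lebesgue_tuple R n).
Variables (a : I -> 'I_n.+1 -> R) (k d : I -> R).
Hypothesis a0 : forall j, a j ord0 != 0.
Hypothesis bnd : forall k', exists B : R, forall t, hpoly a k' t ->
  forall i, `|tnth t i| <= B.
(** No two constraints share their bounding hyperplane; parallel hyperplanes are allowed. *)
Hypothesis distinct : forall i j, i != j ->
  ~ exists s, (forall l, a i l = s * a j l) /\ k i = s * k j.

Let J : pred I := fun j => 0 < a j ord0.
(** The line over [t] parallel to the first axis meets the hyperplane of constraint [j] at first
    coordinate [u t j], which moves with speed [e j]; [w ep t] is the length of the section at time
    [ep]. *)
Let u (t : n.-tuple T) j : R := (k j - dot (a j \o lift ord0) t) / a j ord0.
Let e j := d j / a j ord0.
Let w ep t := seglen J (fun i => u t i + ep * e i).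

Let sectionE ep t :
  [set x | hpoly a (fun j => k j + ep * d j) (consT x t)] =
  seg J (fun i => u t i + ep * e i).
Proof.
apply/seteqP; split=> x /= h j; move: (h j); rewrite dot_cons /u /e /J;
  rewrite mulrA -mulrDl; have [a_gt|a_lt|a_eq] := ltgtP 0 (a j ord0);
  rewrite ?ler_pdivlMr ?ler_ndivrMr//; try (by move: (a0 j); rewrite -a_eq eqxx);
  lra.
Qed.

(** If nothing bounded the first coordinate from above, the polyhedron would contain a half-line:
    the chosen [x] exceeds [B] and every quotient [k j / a j ord0]. *)
Let J1 : exists j, J j.
Proof.
apply: contrapT => nJ; have [B hB] := bnd k.
pose x := `|B| + 1 + \sum_j `|k j / a j ord0|.
have x0 : 0 <= \sum_j `|k j / a j ord0| by apply: sumr_ge0.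
have B0 : 0 <= `|B| by [].
have Bx : B < x by rewrite /x; have := ler_norm B; lra.
have hx : hpoly a k (consT x [tuple (0 : T) | _ < n]).
  move=> j; rewrite dot_cons /dot big1 ?addr0; last first.
    by move=> i _; rewrite tnth_mktuple mulr0.
  have aj : a j ord0 < 0.
    rewrite lt_neqAle a0 leNgt; apply/negP => aj; apply: nJ; by exists j.
  rewrite mulrC -ler_ndivrMr//.
  apply: (@le_trans _ _ (\sum_j `|k j / a j ord0|)).
    by rewrite (bigD1 j)//= ler_wpDr ?ler_norm// sumr_ge0.
  rewrite /x; lra.
have := hB _ hx ord0.
by rewrite tnth_cons0 leNgt (lt_le_trans Bx)// ler_norm.
Qed.

Let J0 : exists j, ~~ J j.
Proof.
apply: contrapT => nJ; have [B hB] := bnd k.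
pose x := - (`|B| + 1 + \sum_j `|k j / a j ord0|).
have x0 : 0 <= \sum_j `|k j / a j ord0| by apply: sumr_ge0.
have B0 : 0 <= `|B| by [].
have Bx : B < - x by rewrite /x; have := ler_norm B; lra.
have hx : hpoly a k (consT x [tuple (0 : T) | _ < n]).
  move=> j; rewrite dot_cons /dot big1 ?addr0; last first.
    by move=> i _; rewrite tnth_mktuple mulr0.
  have aj : 0 < a j ord0.
    apply: contrapT => aj; apply: nJ; exists j; exact/negP.
  rewrite mulrC -ler_pdivlMr//.
  apply: (@le_trans _ _ (- \sum_j `|k j / a j ord0|)); first by rewrite /x; lra.
  rewrite lerNl; apply: le_trans (ler_norm _) _.
  by rewrite normrN (bigD1 j)//= lerDl sumr_ge0.
have := hB _ hx ord0.
by rewrite tnth_cons0 leNgt (lt_le_trans Bx)// -normrN ler_norm.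
Qed.

Let volE ep : mu n.+1 (hpoly a (fun j => k j + ep * d j)) =
  (\int[mu n]_t (w ep t)%:E)%E.
Proof.
rewrite lebesgue_tupleE2; last exact: measurable_hpoly.
by apply: eq_integral => t _; rewrite sectionE lebesgue_segE.
Qed.

Let measurable_w ep : measurable_fun setT (w ep).
Proof.
apply/measurable_EFinP.
have := measurable_tuple_section2
  (measurable_hpoly a (fun j => k j + ep * d j)).
congr measurable_fun; apply/funext => t /=.
by rewrite sectionE lebesgue_segE.
Qed.

Let w_ge0 ep t : 0 <= w ep t.
Proof. by rewrite /w /seglen fine_ge0. Qed.

Let integrable_w ep : (mu n).-integrable setT (EFin \o w ep).
Proof.
apply/integrableP; split; first exact/measurable_EFinP.
under eq_integral do rewrite gee0_abs ?lee_fin//.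
rewrite -volE; have [B hB] := bnd (fun j => k j + ep * d j).
rewrite -ge0_fin_numE//.
by apply: lebesgue_tuple_bounded_fin hB; exact: measurable_hpoly.
Qed.

Let Vol ep := fine (mu n.+1 (hpoly a (fun j => k j + ep * d j))).
Let h ep t : R := (w ep t - w 0 t) / ep.

Let measurable_h ep : measurable_fun setT (h ep).
Proof.
by apply: measurable_funM => //; apply: measurable_funB.
Qed.

Let h_le ep t : ep != 0 -> `|h ep t| <= (\sum_j `|e j|) *+ 2.
Proof.
move=> ep0; rewrite /h normrM normfV ler_pdivrMr ?normr_gt0// mulrC mulrnAr.
apply: (le_trans (seglen_lipschitz J1 J0 (D := `|ep| * \sum_j `|e j|) _)) => // i.
rewrite mul0r addr0 addrAC subrr add0r normrM ler_wpM2l//.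
by rewrite (bigD1 i)//= lerDl sumr_ge0.
Qed.

Let VolE ep : ep != 0 ->
  ((Vol ep - Vol 0) / ep)%:E = (\int[mu n]_t (h ep t)%:E)%E.
Proof.
move=> ep0; rewrite /Vol !volE.
have := @RintegralB _ _ _ (mu n) setT (w ep) (w 0) measurableT
  (integrable_w _) (integrable_w _); rewrite {2 3}/Rintegral => <-.
have iB := integrableB measurableT (integrable_w ep) (integrable_w 0).
rewrite -RintegralZr//; rewrite /Rintegral fineK//.
apply: integrable_fin_num => //.
have := integrableZr measurableT ep^-1 iB.
by apply: eq_integrable => // t _ /=; rewrite EFinM.
Qed.

(** For |ep| at most [M] all the polyhedra lie in the bounded one with levels k_j + M |d_j|, so the
    difference quotients have a common bounded support. *)
Let h_supp M : exists B : R, 0 <= B /\ forall ep t, `|ep| <= M ->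
  ~ tuple_box (fun=> 0) B t -> w ep t = 0.
Proof.
have [B hB] := bnd (fun j => k j + M * `|d j|).
exists (Num.max 0 B); split; first by rewrite le_max lexx.
move=> ep t epM tB; rewrite /w /seglen -sectionE.
rewrite (_ : mkset _ = set0) ?measure0//.
apply/seteqP; split=> // x /= hx; apply: tB => i.
rewrite subr0 le_max; apply/orP; right.
rewrite -(tnth_consS x); apply: hB => j; apply: le_trans (hx j) _.
rewrite lerD2l (le_trans (ler_norm _))// normrM ler_wpM2r//.
Qed.

(** Endpoints [i] and [j] coincide exactly over a hyperplane, which is null, unless [q] vanishes. In
    that case their difference is the constant [c], and [c = 0] would make the two constraints
    proportional, against [distinct]. *)
Let ae_inj : {ae mu n, forall t, injective (u t)}.
Proof.
have : {ae mu n, forall t, forall ij : I * I, ij.1 != ij.2 -> u t ij.1 <> u t ij.2}.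
  have FF : Filter (almost_everywhere (mu n)) by typeclasses eauto.
  have hf := @filter_forall _ (I * I)%type (fun ij => [set t | ij.1 != ij.2 ->
    u t ij.1 <> u t ij.2]) (almost_everywhere (mu n)) FF.
  apply: hf => -[i j] /=.
  have [->|ij] := eqVneq i j; first exact: aeW.
  pose q l := a i (lift ord0 l) / a i ord0 - a j (lift ord0 l) / a j ord0.
  pose c := k i / a i ord0 - k j / a j ord0.
  have uE t : u t i = u t j <-> dot q t = c.
    have -> : dot q t = dot (a i \o lift ord0) t / a i ord0 -
                       dot (a j \o lift ord0) t / a j ord0.
      rewrite /dot !mulr_suml -sumrB; apply: eq_bigr => l _ /=.
      by rewrite /q; ring.
    rewrite /u /c !mulrBl; split; lra.
  apply: (@negligibleS _ _ _ (mu n) [set t | dot q t = c]).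
    by move=> t /= /not_implyP[_ /contrapT/uE].
  apply/negligibleP; first exact: measurable_dot_eq.
  have [[l ql]|q0] := pselect (exists l, q l != 0).
    by apply: hyperplane_null; exists l.
  have {}q0 l : q l = 0.
    by apply/eqP; apply: contra_notT q0 => ql; exists l.
  have -> : [set t : n.-tuple T | dot q t = c] = set0; last exact: measure0.
  apply/seteqP; split=> // t /=; rewrite /dot big1; last first.
    by move=> l _; rewrite q0 mul0r.
  move=> /esym c0; apply: (distinct ij); exists (a i ord0 / a j ord0).
  split=> [l|]; last first.
    apply: (mulIf (invr_neq0 (a0 i))); move/eqP: c0; rewrite subr_eq0 => /eqP ->.
    by field; rewrite !a0.
  case: (unliftP ord0 l) => [l' ->|->]; last by rewrite divfK.
  apply: (mulIf (invr_neq0 (a0 i))); move/eqP: (q0 l'); rewrite subr_eq0 => /eqP ->.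
  by field; rewrite !a0.
apply: filterS => t ht i j uij; apply/eqP; apply: contraPT uij => ij.
exact: (ht (i, j)).
Qed.

Lemma volume_derivable_transverse : derivable Vol 0 1.
Proof.
(* An upper limit along one fixed sequence is measurable and defined everywhere; for almost every
   [t] it is the limit of the difference quotients along any sequence. *)
pose G t := limn_esup (fun m => (h (harmonic m) t)%:E).
have mG : measurable_fun setT G.
  by apply: measurable_fun_limn_esup => m; apply/measurable_EFinP.
have hG p : (forall m, p m != 0) -> p @ \oo --> (0 : R) ->
    {ae mu n, forall t, setT t -> (h (p m) t)%:E @[m --> \oo] --> G t}.
  move=> p0 pc; move: ae_inj; apply: filterS => t uI _.
  have [l hl] := seglen_locally_affine J1 J0 e uI.
  have key p' : (forall m, p' m != 0) -> p' @ \oo --> (0 : R) ->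
      (h (p' m) t)%:E @[m --> \oo] --> l%:E.
    move=> p'0 p'c; apply: cvg_near_cst.
    have hl' : \forall m \near \oo, seglen J (fun i => u t i + p' m * e i) =
      seglen J (u t) + p' m * l by exact: p'c _ hl.
    move: hl'; apply: filterS => m hm.
    rewrite /h /w hm; under [X in _ - seglen _ X]eq_fun do rewrite mul0r addr0.
    by congr EFin; rewrite addrAC subrr add0r mulrC mulKf.
  have -> : G t = l%:E; last exact: key.
  apply: (cvg_limn_einf_sup _).2; apply: key; last exact: cvg_harmonic.
  by move=> m; rewrite gt_eqF// harmonic_gt0.
have main p : (forall m, p m != 0) -> p @ \oo --> (0 : R) ->
    (Vol (p m) - Vol 0) / p m @[m --> \oo] --> fine (\int[mu n]_t G t)%E.
  move=> p0 pc.
  have /cvg_seq_bounded/pinfty_ex_gt0[M M0 pM] : cvgn p by apply/cvg_ex; exists 0.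
  have [B [B0 hB]] := h_supp M.
  (* The dominating function is the Lipschitz constant times the indicator of a box outside which
     all sections are empty. *)
  pose D := (\sum_j `|e j|) *+ 2.
  pose g (t : n.-tuple T) : \bar R := (D * \1_(@tuple_box R n (fun=> 0) B) t)%:E.
  have mB := @measurable_tuple_box R n (fun=> 0) B.
  have ig : (mu n).-integrable setT g.
    rewrite /g; under eq_fun do rewrite EFinM.
    apply: integrableZl => //.
    apply/integrableP; split; first exact/measurable_EFinP.
    under eq_integral do rewrite gee0_abs ?lee_fin//.
    rewrite integral_indic// setIT.
    by rewrite [ltLHS](lebesgue_tuple_box (fun=> 0) B0) ltry.
  have dom : {ae mu n, forall t m, setT t -> (`|(h (p m) t)%:E| <= g t)%E}.
    apply: aeW => t m _; rewrite /g /= lee_fin indicE.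
    have [tB|tB] := boolP (t \in _); first by rewrite mulr1; exact: h_le.
    have w0 ep : `|ep| <= M -> w ep t = 0.
      by move=> epM; apply: (hB _ t epM) => tB'; move/negP: tB; rewrite inE.
    rewrite mulr0 /h (w0 _ (pM m _))// (w0 0); last by rewrite normr0 ltW.
    by rewrite subrr mul0r normr0.
  have mh m : measurable_fun setT (EFin \o h (p m)) by apply/measurable_EFinP.
  have [iG _ cG] := dominated_convergence measurableT mh mG (hG _ p0 pc) ig dom.
  have : ((Vol (p m) - Vol 0) / p m)%:E @[m --> \oo] -->
      (fine (\int[mu n]_t G t))%:E.
    rewrite fineK; last exact: integrable_fin_num.
    by under eq_fun do rewrite VolE//.
  exact: fine_cvg.
apply/cvg_ex; exists (fine (\int[mu n]_t G t)%E).
apply/cvgr_dnbhsP => p [p0 pc].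
apply: cvg_trans (main _ p0 pc); apply: near_eq_cvg; apply: nearW => m /=.
by rewrite [p m *: 1]mulr1 addr0 mulrC.
Qed.

End volume_derivable_transverse.

(** The product [P] is nonzero, hence has fewer than [size P] roots, and some natural number below
    [size P] is not a root. *)
Lemma common_nonroot (R : numDomainType) (I : finType) (p : I -> {poly R}) :
  (forall j, p j != 0) -> exists x, forall j, ~~ root (p j) x.
Proof.
move=> p0; pose P := \prod_j p j.
have P0 : P != 0 by apply/prodf_neq0 => j _.
have [x Px] : exists x, ~~ root P x.
  pose s := [seq (i%:R : R) | i <- iota 0 (size P)].
  have [/allP rs|/allPn[x _ nx]] := boolP (all (root P) s); last by exists x.
  have us : uniq s.
    by rewrite map_inj_uniq ?iota_uniq// => i j /eqP; rewrite eqr_nat => /eqP.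
  have := max_poly_roots P0 (introT allP rs) us.
  by rewrite size_map size_iota ltnn.
exists x => j; apply: contraNN Px => /rootP jx.
by apply/rootP; rewrite /P horner_prod (bigD1 j)//= jx mul0r.
Qed.

Section volume_derivable.
Context {R : realType} {n : nat} {I : finType}.
Local Notation T := (measurableTypeR R).

Lemma consT_eta (t : n.+1.-tuple T) : exists x s, t = consT x s.
Proof. by exists (thead t), [tuple of behead t]; rewrite {1}(tuple_eta t). Qed.

Lemma volume_derivable (a : I -> 'I_n.+1 -> R) (k d : I -> R) :
  (forall j, exists l, a j l != 0) ->
  (forall k', exists B : R, forall t, hpoly a k' t ->
     forall i, `|tnth t i| <= B) ->
  (forall i j, i != j ->
     ~ exists s, (forall l, a i l = s * a j l) /\ k i = s * k j) ->
  derivable (fun ep : R => fine (@lebesgue_tuple R n.+1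
    (hpoly a (fun j => k j + ep * d j))) : R) 0 1.
Proof.
move=> a0 bnd distinct.
(* The entries of a conormal are the coefficients of a polynomial whose value at [x] is the first
   entry of the sheared conormal. A common non-root makes all these first entries nonzero at
   once. *)
have [x px] : exists x, forall j, ~~ root (\poly_(i < n.+1) a j (inord i)) x.
  apply: common_nonroot => j; have [l al] := a0 j.
  apply: contraNneq al => /polyP/(_ l).
  by rewrite coef_poly ltn_ord inord_val coef0 => ->.
(* The shear by [w] makes every conormal transverse to the first axis. *)
pose w (i : 'I_n) := x ^+ i.+1.
pose c j := a j ord0 + \sum_i a j (lift ord0 i) * w i.
pose a' j (i : 'I_n.+1) := if unlift ord0 i is Some l then a j i else c j.
have a'0 j : a' j ord0 = c j by rewrite /a' unlift_none.
have a'S j i : a' j (lift ord0 i) = a j (lift ord0 i) by rewrite /a' liftK.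
have pre k' : hpoly a' k' = shearT w @^-1` hpoly a k'.
  suff E j t : dot (a' j) t = dot (a j) (shearT w t).
    by apply/seteqP; split=> t /= h j; move: (h j); rewrite E.
  have [y [s ->]] := consT_eta t.
  rewrite shearT_cons !dot_cons a'0 /c mulrDl -addrA; congr (_ + _).
  rewrite /dot mulr_suml -big_split/=; apply: eq_bigr => i _.
  by rewrite a'S tnth_mktuple; ring.
have -> : (fun ep => fine (@lebesgue_tuple R n.+1
      (hpoly a (fun j => k j + ep * d j)))) =
    (fun ep => fine (@lebesgue_tuple R n.+1
      (hpoly a' (fun j => k j + ep * d j)))).
  by apply/funext => ep; rewrite pre lebesgue_tuple_shear//;
    exact: measurable_hpoly.
apply: volume_derivable_transverse => [j|k'|i j /distinct h [s [sa sk]]].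
- rewrite a'0 /c; apply: contraNneq (px j) => c0; apply/rootP.
  rewrite horner_poly big_ord_recl expr0 mulr1.
  rewrite -[RHS]c0; congr (_ + _).
    by congr (a j _); apply/val_inj; rewrite /= inordK.
  apply: eq_bigr => i _; congr (a j _ * _).
  by apply/val_inj; rewrite /= inordK// ltnS.
- have [B hB] := bnd k'.
  (* Undoing the shear changes coordinate [l] by [w l * y], where |y| is at most |B|. *)
  exists (`|B| + `|B| * \sum_i `|w i|) => t.
  have [y [s ->]] := consT_eta t.
  rewrite pre /= shearT_cons => /hB h.
  have y_le : `|y| <= `|B|.
    have := h ord0; rewrite !tnth_cons0 => /le_trans; apply; exact: ler_norm.
  have S0 : 0 <= `|B| * \sum_i `|w i| by rewrite mulr_ge0// sumr_ge0.
  move=> i; case: (unliftP ord0 i) => [l|] ->; last first.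
    by rewrite tnth_cons0; apply: le_trans y_le _; rewrite lerDl.
  have := h (lift ord0 l); rewrite !tnth_consS tnth_mktuple mul1r => hl.
  rewrite -(addrK (w l * y) (tnth s l)); apply: le_trans (ler_normB _ _) _.
  apply: lerD; first exact: le_trans hl (ler_norm _).
  rewrite normrM mulrC ler_pM// (bigD1 l)//= lerDl sumr_ge0//.
- apply: h; exists s; split=> // l.
  (* The entries after the first are proportional, hence so are the corrections made by the shear;
     they cancel, which leaves the proportionality of the original first entries. *)
  have S i' : a i (lift ord0 i') = s * a j (lift ord0 i') by rewrite -!a'S sa.
  case: (unliftP ord0 l) => [l' ->|->]; first exact: S.
  have := sa ord0; rewrite !a'0 /c mulrDr mulr_sumr.
  under eq_bigr do rewrite S -mulrA.
  by move/addIr.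
Qed.

End volume_derivable.

(** A step size that respects finitely many positive gaps. The 1 in the minimum covers an empty [I],
    and the 1 in the denominator avoids a division by 0. *)
Lemma common_scale (R : realFieldType) (I : finType) (c g : I -> R) :
  (forall j, 0 < g j) -> exists2 d, 0 < d & forall j, d * c j <= g j.
Proof.
move=> g0; pose h j := g j / (1 + `|c j|).
have c1 j : 0 < 1 + `|c j| by rewrite ltr_pwDl.
exists (\big[Num.min/1]_j h j).
  by apply: lt_bigmin => // j _; rewrite divr_gt0.
move=> j; have d0 : 0 <= \big[Num.min/1]_j h j.
  by apply: le_bigmin => // i _; rewrite divr_ge0 ?ltW.
apply: (@le_trans _ _ ((\big[Num.min/1]_j h j) * (1 + `|c j|))).
  by apply: ler_wpM2l => //; rewrite -[leLHS]add0r lerD// ler_norm.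
by rewrite -ler_pdivlMr//; exact: bigmin_le_cond.
Qed.

(** As [c] is positive, an infinite value stays infinite, and [fine] sends it to 0 on both sides. *)
Lemma fineZ (R : realDomainType) (c : R) (y : \bar R) : 0 < c ->
  fine (c%:E * y)%E = c * fine y.
Proof.
move=> c0; case: y => [r| |]; first by [].
- by rewrite gt0_muley ?lte_fin//= mulr0.
- by rewrite gt0_muleNy ?lte_fin//= mulr0.
Qed.

(** * Volumes under dilations and translations *)

Section volumes.
Context {R : realType} {n : nat} {I : finType}.
Local Notation T := (measurableTypeR R).
Implicit Types (a : I -> 'I_n -> R) (k d : I -> R).

Definition vol a k : R := fine (@lebesgue_tuple R n (hpoly a k)).

Lemma dot_affT (q : 'I_n -> R) s v t :
  dot q (affT s v t) = s * dot q t + \sum_i q i * v i.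
Proof.
rewrite /dot mulr_sumr -big_split; apply: eq_bigr => i _ /=.
by rewrite tnth_mktuple; ring.
Qed.

Lemma hpoly_affT a k s v : 0 < s ->
  affT s v @^-1` hpoly a (fun j => s * k j + \sum_i a j i * v i) = hpoly a k.
Proof.
by move=> s0; apply/seteqP; split=> t /= h j; move: (h j);
  rewrite dot_affT lerD2r ler_pM2l.
Qed.

Lemma vol_affine a k s v : 0 < s ->
  vol a (fun j => s * k j + \sum_i a j i * v i) = s ^+ n * vol a k.
Proof.
move=> s0; rewrite /vol -(hpoly_affT a k v s0) lebesgue_tuple_affine//; last first.
  exact: measurable_hpoly.
rewrite fineZ ?exprn_gt0 ?invr_gt0//.
by rewrite mulrA -exprMn mulfV ?gt_eqF// expr1n mul1r.
Qed.

(** A strictly feasible point is the center of a small cube inside the polyhedron. Boundedness keeps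
    the measure finite, so that [fine] does not collapse it to 0. *)
Lemma vol_gt0 a k : (exists x, forall j, \sum_i a j i * x i < k j) ->
  (forall k', exists B : R, forall t, hpoly a k' t ->
     forall i, `|tnth t i| <= B) ->
  0 < vol a k.
Proof.
move=> [x xk] bnd.
have gap j : 0 < k j - \sum_i a j i * x i by rewrite subr_gt0.
have [d d0 dj] := common_scale (fun j => \sum_i `|a j i|) gap.
have sub : tuple_box x d `<=` hpoly a k.
  move=> t ht j; rewrite -(subrK (\sum_i a j i * x i) (dot _ _)) -lerBrDr.
  apply: le_trans (dj j); rewrite /dot -sumrB mulr_sumr; apply: ler_sum => i _.
  rewrite -mulrBr mulrC; apply: le_trans (ler_norm _) _.
  by rewrite normrM ler_wpM2r.
have [B hB] := bnd k.
have mf := lebesgue_tuple_bounded_fin (measurable_hpoly a k) hB.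
rewrite -lte_fin fineK//; apply: lt_le_trans (le_measure _ _ _ sub).
- by rewrite [ltRHS](lebesgue_tuple_box x (ltW d0)) lte_fin exprn_gt0// mulrn_wgt0.
- by rewrite inE; exact: measurable_tuple_box.
- by rewrite inE; exact: measurable_hpoly.
Qed.

End volumes.

(** * First moments as volumes of regions under graphs *)

Section moments.
Context {R : realType} {n : nat} {I : finType}.
Local Notation T := (measurableTypeR R).
Implicit Types (a : I -> 'I_n -> R) (k d : I -> R).

Definition moment a k (i : 'I_n) : R :=
  \int[@lebesgue_tuple R n]_(t in hpoly a k) tnth t i.

(* [lift_normal] and [lift_level] describe the region under the graph of
   [x |-> x_i + B] over [hpoly a k]; the height is the new coordinate [ord0]. *)
Definition lift_normal a (i : 'I_n) (o : option (option I)) (l : 'I_n.+1) : R :=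
  match o, unlift ord0 l with
  | None, None => -1
  | None, Some _ => 0
  | Some None, None => 1
  | Some None, Some l' => - (l' == i)%:R
  | Some (Some j), None => 0
  | Some (Some j), Some l' => a j l'
  end.

Definition lift_level (B : R) k (o : option (option I)) : R :=
  match o with
  | None => 0
  | Some None => B
  | Some (Some j) => k j
  end.

Lemma lift_normal0 a i o : lift_normal a i o ord0 =
  match o with None => -1 | Some None => 1 | _ => 0 end.
Proof. by rewrite /lift_normal unlift_none; case: o => [[]|]. Qed.

Lemma lift_normalS a i o l : lift_normal a i o (lift ord0 l) =
  match o with None => 0 | Some None => - (l == i)%:R | Some (Some j) => a j l end.
Proof. by rewrite /lift_normal liftK; case: o => [[]|]. Qed.

Lemma sum_delta (i : 'I_n) (v : 'I_n -> R) :
  \sum_l - (l == i)%:R * v l = - v i.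
Proof.
rewrite (bigD1 i)//= eqxx mulN1r big1 ?addr0// => l /negbTE ->.
by rewrite oppr0 mul0r.
Qed.

Lemma dot_lift a i o z t : dot (lift_normal a i o) (consT z t) =
  match o with
  | None => - z
  | Some None => z - tnth t i
  | Some (Some j) => dot (a j) t
  end.
Proof.
rewrite dot_cons lift_normal0 /dot /comp.
under eq_bigr do rewrite lift_normalS.
case: o => [[j|]|]; last by rewrite mulN1r big1 ?addr0// => l _; rewrite mul0r.
  by rewrite mul0r add0r.
by rewrite mul1r sum_delta.
Qed.

Lemma hpoly_liftE a i B k z t :
  hpoly (lift_normal a i) (lift_level B k) (consT z t) <->
  hpoly a k t /\ 0 <= z <= tnth t i + B.
Proof.
split=> [h|[h /andP[z0 zB]] o].
  split; first by move=> j; have := h (Some (Some j)); rewrite dot_lift.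
  have := h None; have := h (Some None); rewrite !dot_lift/=.
  by rewrite oppr_le0 lerBlDl => -> ->.
rewrite dot_lift; case: o => [[j|]|] /=; first exact: h.
  by rewrite lerBlDl.
by rewrite oppr_le0.
Qed.

(** Over [t] the region is the segment from 0 to [tnth t i + B], and the choice of [B] makes this
    length nonnegative. *)
Lemma vol_lift a i B k : (forall t, hpoly a k t -> forall i, `|tnth t i| <= B) ->
  vol (lift_normal a i) (lift_level B k) =
  moment a k i + B * vol a k.
Proof.
move=> hB; rewrite {1}/vol lebesgue_tupleE2; last exact: measurable_hpoly.
have mA := measurable_hpoly a k.
have mfin := lebesgue_tuple_bounded_fin mA hB.
have mti : measurable_fun (hpoly a k) (fun t => tnth t i).
  by apply: measurable_funTS; exact: measurable_tnth.
have B0 t : hpoly a k t -> 0 <= B.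
  by move=> At; exact: le_trans (normr_ge0 _) (hB t At i).
have icst (c : R) : (@lebesgue_tuple R n).-integrable (hpoly a k) (EFin \o cst c).
  apply/integrableP; split; first exact/measurable_EFinP.
  by rewrite /= integral_cst//= lte_mul_pinfty ?lee_fin// -ge0_fin_numE.
have iti : (@lebesgue_tuple R n).-integrable (hpoly a k) (EFin \o (fun t => tnth t i)).
  apply: (le_integrable mA _ _ (icst B)); first exact/measurable_EFinP.
  move=> t At /=; rewrite lee_fin (ger0_norm (B0 _ At)); exact: hB.
transitivity (\int[@lebesgue_tuple R n]_(t in hpoly a k) (tnth t i + B)).
  congr fine; rewrite [RHS]integral_mkcond; apply: eq_integral => t _.
  rewrite patchE; case: ifPn => tA.
    have At : hpoly a k t by rewrite inE in tA.
    have tB : 0 <= tnth t i + B.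
      by have := hB t At i; rewrite ler_norml => /andP[]; lra.
    rewrite (_ : mkset _ = [set` `[0, tnth t i + B]]).
      rewrite lebesgue_measure_itv/= lte_fin; case: ltP => h.
        by rewrite oppr0 adde0.
      by congr EFin; apply/eqP; rewrite eq_le tB h.
    apply/seteqP; split=> z /=; rewrite in_itv/=.
      by move=> /hpoly_liftE[].
    by move=> h; apply/hpoly_liftE.
  rewrite (_ : mkset _ = set0) ?measure0//.
  apply/seteqP; split=> // z /= /hpoly_liftE[At _].
  by move/negP: tA; rewrite inE.
rewrite RintegralD//; last exact: icst.
by rewrite Rintegral_cst.
Qed.

(** Acting on the base by t -> s t + v and on the height by multiplication with [s] carries one
    region under a graph to another, so the rule for volumes suffices. *)
Lemma moment_affine a k s v i :
  (forall k', exists B : R, forall t, hpoly a k' t ->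
     forall i, `|tnth t i| <= B) -> 0 < s ->
  moment a (fun j => s * k j + \sum_i a j i * v i) i =
  s ^+ n.+1 * moment a k i + v i * s ^+ n * vol a k.
Proof.
move=> bnd s0; set k' := fun j => _.
have [B hB] := bnd k; have [B' hB'] := bnd k'.
(* Large enough that [C] bounds the coordinates at the levels [k], and [s * C - v i] those at the
   levels [k']. *)
pose C := `|B| + (`|B'| + `|v i|) / s.
have s1 : 0 <= (`|B'| + `|v i|) / s by apply: divr_ge0; [exact: addr_ge0|exact: ltW].
have CB : B <= C by rewrite /C; have := ler_norm B; lra.
have CB' : B' <= s * C - v i.
  rewrite /C mulrDr mulrCA mulfV ?gt_eqF// mulr1.
  have := ler_norm B'; have := ler_norm (v i).
  have : 0 <= s * `|B| by rewrite mulr_ge0// ltW.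
  lra.
have e1 := @vol_lift a i C k (fun t ht l => le_trans (hB t ht l) CB).
have e2 := @vol_lift a i (s * C - v i) k' (fun t ht l => le_trans (hB' t ht l) CB').
pose v' (l : 'I_n.+1) := if unlift ord0 l is Some l' then v l' else 0.
have lkE : lift_level (s * C - v i) k' = fun o => s * lift_level C k o +
     \sum_l lift_normal a i o l * v' l.
  apply/funext => o; rewrite big_ord_recl {1}/v' unlift_none mulr0 add0r.
  under eq_bigr do rewrite lift_normalS /v' liftK.
  case: o => [[j|]|] //=; first by rewrite sum_delta.
  by rewrite mulr0 big1 ?addr0// => l _; rewrite mul0r.
move: e2; rewrite lkE vol_affine// e1 vol_affine// => e2.
apply: (addIr ((s * C - v i) * (s ^+ n * vol a k))).
by rewrite -e2 exprS; ring.
Qed.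

End moments.

(** * Coordinates of the center of mass *)

Section com.
Context {R : realType} {n : nat} {I : finType}.
Local Notation T := (measurableTypeR R).
Variables (a : I -> 'I_n -> R).
Hypothesis a_neq0 : forall j, exists l, a j l != 0.
Hypothesis bnd : forall k', exists B : R, forall t, hpoly a k' t ->
     forall i, `|tnth t i| <= B.

Lemma lift_bounded i k' : exists B : R, forall t, hpoly (lift_normal a i) k' t ->
  forall l, `|tnth t l| <= B.
Proof.
have [B hB] := bnd (fun j => k' (Some (Some j))).
exists (`|B| + `|k' None| + `|k' (Some None)|) => t.
have [z [s ->]] := consT_eta t => h.
have hs : hpoly a (fun j => k' (Some (Some j))) s.
  by move=> j; have := h (Some (Some j)); rewrite dot_lift.
have B1 l : `|tnth s l| <= `|B| by exact: le_trans (hB _ hs l) (ler_norm _).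
have n1 : 0 <= `|k' None| by [].
have n2 : 0 <= `|k' (Some None)| by [].
move=> l; case: (unliftP ord0 l) => [l'|] ->.
  by rewrite tnth_consS; have := B1 l'; lra.
have := h None; have := h (Some None); rewrite !dot_lift tnth_cons0.
have := B1 i; rewrite ler_norml => /andP[? ?].
have := ler_norm (k' None); have := ler_norm (k' (Some None)).
move=> ? ? ? ?; rewrite ler_norml; apply/andP; split; lra.
Qed.

Variable (k d : I -> R).
Hypothesis distinct : forall i j, i != j ->
  ~ exists s, (forall l, a i l = s * a j l) /\ k i = s * k j.

Let kd (ep : R) j := k j + ep * d j.

(** The index [i] witnesses that [n] is positive. *)
Lemma vol_derivable (i : 'I_n) : derivable (fun ep : R => vol a (kd ep) : R) 0 1.
Proof.
case: n i a a_neq0 bnd distinct => [[]//|n'] i a' h1 h2 h3.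
exact: volume_derivable.
Qed.

Lemma vol_lift_derivable i B : derivable (fun ep : R =>
  vol (lift_normal a i) (lift_level B (kd ep)) : R) 0 1.
Proof.
(* The constraints of the base move, while floor and roof keep their levels. *)
pose ld (o : option (option I)) := if o is Some (Some j) then d j else 0.
rewrite (_ : (fun ep => _) = fun ep : R => vol (lift_normal a i)
    (fun o => lift_level B k o + ep * ld o)); last first.
  apply/funext => ep; congr vol; apply/funext => -[[j|]|] //=.
    by rewrite mulr0 addr0.
  by rewrite mulr0 addr0.
apply: volume_derivable => [|k'|].
- move=> [[j|]|]; last 2 first.
  + by exists ord0; rewrite lift_normal0 oner_neq0.
  + by exists ord0; rewrite lift_normal0 oppr_eq0 oner_neq0.
  by have [l al] := a_neq0 j; exists (lift ord0 l); rewrite lift_normalS.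
- exact: lift_bounded.
- have nz j : ~ forall l, a j l = 0.
    by move=> h; have [l] := a_neq0 j; rewrite h eqxx.
  have n10 : (-1 : R) <> 0 by apply/eqP; rewrite oppr_eq0 oner_neq0.
  have p10 : (1 : R) <> 0 by apply/eqP; rewrite oner_neq0.
  (* Two base constraints are separated by [distinct]. In all other cases the entries at [ord0] and
     at the places of the base, in particular at [i], exclude proportionality. *)
  move=> o o' oo' [s [hs sk]]; have h0 := hs ord0.
  have hS l := hs (lift ord0 l).
  move: h0; rewrite !lift_normal0 => h0.
  have hi := hS i.
  case: o o' oo' sk h0 hs hS hi => [[j|]|] [[j'|]|] // oo' sk h0 hs hS hi.
  + have jj : j != j' by apply: contra_neq oo' => ->.
    apply: (distinct jj); exists s; split=> // l.
    by have := hS l; rewrite !lift_normalS.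
  + apply: (nz j) => l; have := hS l; rewrite !lift_normalS.
    by move: h0; rewrite mulr1 => <-; rewrite mul0r.
  + by apply: (nz j) => l; have := hS l; rewrite !lift_normalS mulr0.
  + by apply: p10; rewrite h0 mulr0.
  + by move: hi; rewrite !lift_normalS eqxx mulr0.
  + by apply: n10; rewrite h0 mulr0.
  + move: hi; rewrite !lift_normalS eqxx mulrN1 => /esym/eqP.
    rewrite oppr_eq0 => /eqP s0; apply: n10; by rewrite h0 s0 mul0r.
Qed.

(** By [vol_lift] a moment is a difference of volumes. One [B] serves for all |ep| at most 1, as the
    levels then stay below k_j + |d_j|. *)
Lemma moment_derivable i : derivable (fun ep : R => moment a (kd ep) i : R) 0 1.
Proof.
have [B hB] := bnd (fun j => k j + `|d j|).
have near1 : \forall ep \near (0 : R),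
    vol (lift_normal a i) (lift_level B (kd ep)) - B * vol a (kd ep) =
    moment a (kd ep) i.
  near=> ep; rewrite vol_lift ?addrK// => t ht l; apply: hB => j.
  apply: le_trans (ht j) _; rewrite lerD2l (le_trans (ler_norm _))//.
  rewrite normrM ler_piMl//; near: ep; exact: nbhs0_le.
apply: (near_eq_derivable near1).
apply: derivableB; first exact: vol_lift_derivable.
by apply: derivableZ; exact: vol_derivable.
Unshelve. all: by end_near. Qed.

Definition com k i := moment a k i / vol a k.

Lemma com_derivable i : vol a k != 0 ->
  derivable (fun ep : R => com (kd ep) i : R) 0 1.
Proof.
move=> V0; apply: derivableM; first exact: moment_derivable.
apply: derivableV; last exact: vol_derivable.
rewrite (_ : kd 0 = k)//; apply/funext => j; by rewrite /kd mul0r addr0.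
Qed.

Lemma com_affine s v i : vol a k != 0 -> 0 < s ->
  com (fun j => s * k j + \sum_i a j i * v i) i = s * com k i + v i.
Proof.
move=> V0 s0; rewrite /com moment_affine// vol_affine// exprS.
by field; rewrite V0 expf_neq0// gt_eqF.
Qed.

End com.

Section com_rV.
Context {R : realType} {n m : nat} (N : 'I_m -> 'cV[R]_n).
Implicit Types k : 'rV[R]_m.

Definition coefs j i : R := N j i 0.

Lemma pairingE (x : 'rV[R]_n) (v : 'cV[R]_n) : pairing x v = \sum_i x 0 i * v i 0.
Proof. by rewrite /pairing mxE. Qed.

Lemma polyhedron_hpoly k t :
  polyhedron N k (\row_i tnth t i) <-> hpoly coefs (fun j => k 0 j) t.
Proof.
have E j : pairing (\row_i tnth t i) (N j) = dot (coefs j) t.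
  by rewrite pairingE; apply: eq_bigr => i _; rewrite mxE mulrC.
by split=> h j; have := h j; rewrite E.
Qed.

Lemma CmE k i : Cm N k 0 i = com coefs (fun j => k 0 j) i.
Proof.
rewrite /Cm /center_of_mass mxE /com /moment /vol.
suff -> : [set t : n.-tuple (measurableTypeR R) |
  polyhedron N k (\row_i tnth t i)] = hpoly coefs (fun j => k 0 j) by [].
by apply/seteqP; split=> t /polyhedron_hpoly.
Qed.

End com_rV.

(** * The chamber of a Delzant polytope *)

Section pairing_theory.
Context {R : realType} {n : nat}.
Implicit Types (x y : 'rV[R]_n) (v w : 'cV[R]_n).

Lemma pairingDl x y v : pairing (x + y) v = pairing x v + pairing y v.
Proof. by rewrite /pairing mulmxDl mxE. Qed.

Lemma pairingZl s x v : pairing (s *: x) v = s * pairing x v.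
Proof. by rewrite /pairing -scalemxAl mxE. Qed.

Lemma pairingNl x v : pairing (- x) v = - pairing x v.
Proof. by rewrite /pairing mulNmx mxE. Qed.

Lemma pairingBl x y v : pairing (x - y) v = pairing x v - pairing y v.
Proof. by rewrite pairingDl pairingNl. Qed.

Lemma pairingNr x v : pairing x (- v) = - pairing x v.
Proof. by rewrite /pairing mulmxN mxE. Qed.

Lemma pairingZr s x v : pairing x (s *: v) = s * pairing x v.
Proof. by rewrite /pairing -scalemxAr mxE. Qed.

Lemma pairing_sumr (I : finType) (P : pred I) x (v : I -> 'cV[R]_n) :
  pairing x (\sum_(j | P j) v j) = \sum_(j | P j) pairing x (v j).
Proof. by rewrite /pairing mulmx_sumr summxE. Qed.

Lemma pairing_suml (I : finType) (P : pred I) (x : I -> 'rV[R]_n) v :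
  pairing (\sum_(j | P j) x j) v = \sum_(j | P j) pairing (x j) v.
Proof. by rewrite /pairing mulmx_suml summxE. Qed.

Lemma pairing_continuous v : continuous (pairing ^~ v).
Proof.
have -> : pairing ^~ v = fun x => \sum_(i <- index_enum 'I_n) x 0 i * v i 0.
  by apply/funext => x; rewrite pairingE.
elim: (index_enum _) => [|i s IH].
  under eq_fun do rewrite big_nil.
  exact: cst_continuous.
under eq_fun do rewrite big_cons.
have c1 : continuous (fun x : 'rV[R]_n => x 0 i * v i 0).
  by move=> x; apply: continuousM; [exact: coord_continuous|exact: cst_continuous].
by move=> x; exact: (continuousD (c1 x) (IH x)).
Qed.

End pairing_theory.

Section lattice.
Context {R : realType} {n m : nat} (N : 'I_m -> 'cV[R]_n).

(** The integral coordinates of the standard basis vectors are the entries of the dual vectors.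
    Duality follows from uniqueness, as [c1] and [c2] are both coordinate families of [N l]. *)
Lemma lattice_dual_basis (J : {set 'I_m}) : lattice_basis N J ->
  exists D : 'I_m -> 'rV[R]_n,
    (forall j l, j \in J -> l \in J -> pairing (D j) (N l) = (j == l)%:R) /\
    (forall u, u = \sum_(j in J) pairing (D j) u *: N j).
Proof.
move=> [Nint basis].
have /choice[c cP] i : exists c : {ffun 'I_m -> int},
    (forall j, j \notin J -> c j = 0) /\
    delta_mx i 0 = \sum_(j in J) N j *~ c j :> 'cV[R]_n.
  have ei : integral_vec (delta_mx i 0 : 'cV[R]_n).
    by apply/mxOverP => a b; rewrite mxE; exact: rpred_nat.
  by have [c [cP _]] := basis _ ei; exists c.
exists (fun j => \row_i (c i j)%:~R); split; last first.
  move=> u; have uE : u = \sum_i u i 0 *: delta_mx i 0.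
    apply/matrixP => a b; rewrite ord1 summxE (bigD1 a)//= big1 ?addr0.
      by rewrite !mxE !eqxx mulr1.
    by move=> i /negbTE ia; rewrite !mxE eq_sym ia mulr0.
  rewrite {1}uE; under eq_bigr do rewrite (cP _).2 scaler_sumr.
  rewrite exchange_big/=; apply: eq_bigr => j _.
  rewrite pairingE scaler_suml; apply: eq_bigr => i _.
  by rewrite mxE -[N j *~ _]scaler_int scalerA mulrC.
move=> j l jJ lJ.
have /mxOverP Nl := Nint l lJ.
have /choice[z zP] i : exists z : int, N l i 0 = z%:~R.
  by have /intrP := Nl i 0.
have Nlint := Nint l lJ.
pose c1 : {ffun 'I_m -> int} := [ffun j => \sum_i z i * c i j].
pose c2 : {ffun 'I_m -> int} := [ffun j => (j == l)%:R].
have [c0 [_ uc]] := basis _ Nlint.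
have E1 : c0 = c1.
  apply: uc; split=> [j' j'J|].
    by rewrite ffunE big1// => i _; rewrite (cP i).1// mulr0.
  rewrite -[LHS](_ : \sum_i N l i 0 *: delta_mx i 0 = _); last first.
    apply/matrixP => a b; rewrite ord1 summxE (bigD1 a)//= big1 ?addr0.
      by rewrite !mxE !eqxx mulr1.
    by move=> i /negbTE ia; rewrite !mxE eq_sym ia mulr0.
  under eq_bigr do rewrite (cP _).2 scaler_sumr.
  rewrite exchange_big/=; apply: eq_bigr => j' _.
  rewrite ffunE -scaler_int rmorph_sum/= scaler_suml; apply: eq_bigr => i _.
  by rewrite zP -[N j' *~ _]scaler_int scalerA rmorphM.
have E2 : c0 = c2.
  apply: uc; split=> [j' j'J|].
    by rewrite ffunE; case: eqP j'J => // ->; rewrite lJ.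
  rewrite (bigD1 l)//= ffunE eqxx mulr1z big1 ?addr0// => j' /andP[_ /negbTE jl].
  by rewrite ffunE jl mulr0z.
have : c1 j = c2 j by rewrite -E1 E2.
rewrite !ffunE => c12; rewrite pairingE.
transitivity ((\sum_i z i * c i j)%:~R : R); last by rewrite c12; case: eqP.
rewrite rmorph_sum; apply: eq_bigr => i _ /=.
by rewrite mxE zP rmorphM mulrC.
Qed.

End lattice.

(** * Linear programming on a Delzant polytope *)

Section delzant_polytope.
Context {R : realType} {n m : nat} (N : 'I_m -> 'cV[R]_n) (k0 : 'rV[R]_m).
Hypothesis hD : delzant N k0.
Implicit Types (k : 'rV[R]_m) (x y z w v : 'rV[R]_n) (u : 'cV[R]_n).

Let bounded0 : exists M : R, forall x, polyhedron N k0 x -> `|x| <= M.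
Proof.
have [[bP _ _ _] _ _] := hD.
have [M M0 hM] := pinfty_ex_gt0 bP.
by exists M => x Px; exact: hM.
Qed.

Let nonempty0 : exists x, polyhedron N k0 x.
Proof. by have [[_ [[p [_ [Pp _ _]]] _] _ _] _ _] := hD; exists p. Qed.

(** Moving along [w] from a point of the polytope never violates a constraint, so a nonzero [w]
    contradicts boundedness; [s] is such that the displacement has norm M + |x| + 1. *)
Lemma recession_cone0 w : (forall j, pairing w (N j) <= 0) -> w = 0.
Proof.
move=> hw; have [x Px] := nonempty0; have [M hM] := bounded0.
apply/eqP; apply: contraPT (lexx (0 : R)) => w0.
have nw : 0 < `|w| by rewrite normr_gt0.
pose s := (M + `|x| + 1) / `|w|.
have M0 : 0 <= M by exact: le_trans (normr_ge0 x) (hM _ Px).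
have s0 : 0 <= s by rewrite divr_ge0// !addr_ge0.
have Ps : polyhedron N k0 (x + s *: w).
  move=> j; rewrite pairingDl pairingZl -[leRHS]addr0 lerD//.
  by rewrite mulr_ge0_le0.
have := hM _ Ps; have := ler_normB (x + s *: w) x.
rewrite addrAC subrr add0r normrZ (ger0_norm s0) /s divfK ?gt_eqF//.
by lra.
Qed.

Lemma maximizer u : exists x, polyhedron N k0 x /\
  forall y, polyhedron N k0 y -> pairing y u <= pairing x u.
Proof.
have cP : closed (polyhedron N k0).
  rewrite (_ : polyhedron N k0 = \bigcap_(j in [set: 'I_m])
     ((fun x => pairing x (N j)) @^-1` [set r | r <= k0 0 j])).
    apply: closed_bigI => j _; apply: preimage_closed; last exact: closed_le.
    by move=> x _; exact: pairing_continuous.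
  by apply/seteqP; split=> x /= h j => [_|]; [exact: h|exact: (h j Logic.I)].
have [[bP _ _ _] _ _] := hD.
have cu : {within polyhedron N k0, continuous (fun x => pairing x u)}.
  by apply: continuous_subspaceT; exact: pairing_continuous.
have [c cc hc] := EVT_max_rV nonempty0 (bounded_closed_compact bP cP) cu.
exists c; split; first by rewrite inE in cc.
by move=> y Py; apply: hc; rewrite inE.
Qed.

(** Ratio test: [g j] is the time at which constraint [j] becomes tight along [w], and the smallest
    such time is taken. By [recession_cone0] some constraint does increase along [w]. *)
Lemma polyhedron_exit x w : polyhedron N k0 x -> w != 0 ->
  exists s j, [/\ 0 <= s, 0 < pairing w (N j), polyhedron N k0 (x + s *: w) &
    pairing (x + s *: w) (N j) = k0 0 j].
Proof.
move=> Px w0.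
have [j1 j1P] : exists j, 0 < pairing w (N j).
  apply: contrapT => h; move/eqP: w0; apply; apply: recession_cone0 => j.
  by rewrite leNgt; apply/negP => jw; apply: h; exists j.
pose g j := (k0 0 j - pairing x (N j)) / pairing w (N j).
have [j jP jmin] := @arg_minP _ _ _ j1 (fun j => 0 < pairing w (N j)) g j1P.
have gj : 0 <= g j by rewrite divr_ge0 ?(ltW jP)// subr_ge0.
exists (g j), j; split=> // [l|]; last first.
  by rewrite pairingDl pairingZl divfK ?gt_eqF// addrC subrK.
rewrite pairingDl pairingZl.
have [lP|lN] := ltP 0 (pairing w (N l)); last first.
  by rewrite -[leRHS]addr0 lerD// mulr_ge0_le0.
by rewrite -lerBrDl -ler_pdivlMr//; exact: jmin.
Qed.

Lemma facets_atP k x j : polyhedron N k x ->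
  (j \in facets_at N k x) = (pairing x (N j) == k 0 j).
Proof.
move=> Px; rewrite inE; apply/asboolP/eqP => [[]//|xj]; by split.
Qed.

(** A maximiser on the largest number of facets is a vertex. If it were inside a proper segment of
    the polytope, [u] and all tight constraints would be constant along the segment, and following
    its direction to the exit point would gain a facet while staying maximal. *)
Lemma vertex_maximizer u : exists x, [/\ polyhedron N k0 x,
  (forall y, polyhedron N k0 y -> pairing y u <= pairing x u) &
  is_vertex (polyhedron N k0) x].
Proof.
pose is_max x := polyhedron N k0 x /\
  forall y, polyhedron N k0 y -> pairing y u <= pairing x u.
pose P c := `[< exists2 x, is_max x & #|facets_at N k0 x| = c >].
have exP : exists c, P c.
  have [x xm] := maximizer u.
  by exists #|facets_at N k0 x|; apply/asboolP; exists x.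
have ubP c : P c -> (c <= m)%N.
  by move=> /asboolP[x _ <-]; rewrite -[leqRHS]card_ord max_card.
case: (ex_maxnP exP ubP) => c /asboolP[x [Px xm] xc] cmax.
exists x; split=> //; split=> // y z t Py Pz /andP[t0 t1] xE.
have t1' : 0 < 1 - t by rewrite subr_gt0.
have tight q r : pairing y q <= r -> pairing z q <= r -> pairing x q = r ->
    pairing y q = r /\ pairing z q = r.
  move=> yq zq; rewrite xE pairingDl !pairingZl => e.
  have h1 : t * pairing y q <= t * r by rewrite ler_pM2l.
  have h2 : (1 - t) * pairing z q <= (1 - t) * r by rewrite ler_pM2l.
  split; apply/eqP; rewrite eq_le ?yq ?zq /=.
    by rewrite -(ler_pM2l t0); lra.
  by rewrite -(ler_pM2l t1'); lra.
have [yz|yz] := eqVneq y z.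
  have xy : x = y by rewrite xE -yz -scalerDl addrC subrK scale1r.
  by rewrite -yz xy.
have w0 : y - z != 0 by rewrite subr_eq0.
have [s [j [s0 jw Px' jt]]] := polyhedron_exit Px w0.
set x' := x + _ in Px' jt.
have [yu zu] := tight u _ (xm _ Py) (xm _ Pz) erefl.
have x'm : is_max x'.
  split=> // p /xm; rewrite /x' pairingDl pairingZl pairingBl yu zu.
  by rewrite subrr mulr0 addr0.
have wI i : i \in facets_at N k0 x -> pairing (y - z) (N i) = 0.
  rewrite facets_atP// => /eqP xi.
  have [yi zi] := tight (N i) _ (Py i) (Pz i) xi.
  by rewrite pairingBl yi zi subrr.
have sub : facets_at N k0 x \proper facets_at N k0 x'.
  apply/properP; split.
    apply/fintype.subsetP => i iI.
    move: (iI); rewrite !facets_atP// /x' pairingDl pairingZl (wI _ iI).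
    by rewrite mulr0 addr0.
  exists j; first by rewrite facets_atP// jt.
  by apply/negP => /wI jw0; rewrite jw0 ltxx in jw.
have := proper_card sub; rewrite xc ltnNge cmax//.
by apply/asboolP; exists x'.
Qed.

(* LP duality: at a vertex maximising [u] the conormals form a basis, and a
   negative coordinate of [u] would give an improving edge. *)
Lemma conormal_cone u : exists x (a : 'I_m -> R), [/\ polyhedron N k0 x,
  forall j, 0 <= a j, forall j, a j != 0 -> pairing x (N j) = k0 0 j &
  u = \sum_j a j *: N j].
Proof.
have [x [Px xm xv]] := vertex_maximizer u.
have [_ _ /(_ x xv)[_]] := hD.
set J := facets_at N k0 x => /lattice_dual_basis[D [Dd Du]].
exists x, (fun j => if j \in J then pairing (D j) u else 0); split=> //.
- move=> j; case: ifPn => // jJ; rewrite leNgt; apply/negP => neg.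
  pose g l := if l \in J then 1 else k0 0 l - pairing x (N l).
  pose c l := if l \in J then 0 else pairing (- D j) (N l).
  have g0 l : 0 < g l.
    rewrite /g; case: ifPn => // lJ; rewrite subr_gt0 lt_neqAle Px andbT.
    by rewrite -facets_atP.
  have [d d0 dP] := common_scale c g0.
  have Pd : polyhedron N k0 (x + d *: - D j).
    move=> l; rewrite pairingDl pairingZl; have := dP l; rewrite /g /c.
    case: ifPn => [lJ _|_]; last by rewrite lerBrDl.
    rewrite -[leRHS]addr0 lerD// pairingNl Dd// mulrN oppr_le0.
    by rewrite mulr_ge0 ?ler0n// ltW.
  have := xm _ Pd; rewrite pairingDl pairingZl pairingNl gerDl.
  by rewrite leNgt pmulr_rgt0// oppr_gt0 neg.
- by move=> j; case: ifPn => [jJ _|]; rewrite ?eqxx//; apply/eqP; rewrite -facets_atP.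
- rewrite {1}[u]Du big_mkcond/=; apply: eq_bigr => j _.
  by case: ifP => //; rewrite scale0r.
Qed.

(** The nonnegative combinations given by [conormal_cone] involve the conormals and not the levels,
    so they bound each coordinate and its opposite for every [k]. *)
Lemma polyhedron_bounded k : exists B : R, forall x, polyhedron N k x ->
  forall i, `|x 0 i| <= B.
Proof.
have cone u : exists C, forall x, polyhedron N k x -> pairing x u <= C.
  have [_ [a [_ a0 _ ->]]] := conormal_cone u.
  exists (\sum_j a j * k 0 j) => x Px; rewrite pairing_sumr.
  by apply: ler_sum => j _; rewrite pairingZr ler_wpM2l.
have /choice[C hC] i := cone (delta_mx i 0).
have /choice[C' hC'] i := cone (- delta_mx i 0).
exists (\sum_i (`|C i| + `|C' i|)) => x Px i.
have pe : pairing x (delta_mx i 0) = x 0 i.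
  rewrite pairingE (bigD1 i)//= big1 ?addr0 ?mxE ?eqxx ?mulr1// => l /negbTE li.
  by rewrite mxE li mulr0.
apply: (@le_trans _ _ (`|C i| + `|C' i|)).
  have := hC i x Px; have := hC' i x Px; rewrite pairingNr pe.
  have := ler_norm (C i); have := ler_norm (C' i).
  have n1 : 0 <= `|C i| by []. have n2 : 0 <= `|C' i| by [].
  by move=> ? ? ? ?; rewrite ler_norml; apply/andP; split; lra.
by rewrite [leRHS](bigD1 i)//= lerDl sumr_ge0// => l _; exact: addr_ge0.
Qed.

(** For empty [J] the condition is void and does not even place [x] in the polyhedron, so that this
    case is treated apart. *)
Definition face k (J : {set 'I_m}) x := forall j, j \in J -> facet N k j x.

Lemma bigcap_facetP k (J : {set 'I_m}) :
  (\bigcap_(j in [set` J]) facet N k j !=set0) <-> exists x, face k J x.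
Proof. by split=> -[x hx]; exists x => j; have := hx j. Qed.

Lemma chamberP k : chamber N k0 k <->
  forall J, (exists x, face k0 J x) <-> (exists x, face k J x).
Proof.
split=> h J; have := h J; by rewrite !bigcap_facetP.
Qed.

Lemma facet0_neq0 j : exists x, facet N k0 j x.
Proof.
have [[_ _ /(_ j)[d _ [[p [_ [Pp _ _]]] _]] _] _ _] := hD.
by exists p.
Qed.

Lemma conormal_neq0 j : N j != 0.
Proof.
have [_ /(_ j)[Nint hj] _] := hD.
apply/eqP => N0; have := hj 0 0; rewrite N0 mulr0z => /(_ _ erefl).
suff h : integral_vec (0 : 'cV[R]_n) by move=> /(_ h).
by apply/mxOverP => a b; rewrite mxE; exact: rpred0.
Qed.

(** Otherwise the [n] independent directions in [M], given by full dimension, would all annihilate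
    the nonzero vector [N j]. *)
Lemma not_sub_facet0 j : exists2 x, polyhedron N k0 x & pairing x (N j) < k0 0 j.
Proof.
apply: contrapT => h.
have tight x : polyhedron N k0 x -> pairing x (N j) = k0 0 j.
  move=> Px; apply/eqP; rewrite eq_le Px leNgt /=; apply/negP => xj.
  by apply: h; exists x.
have [[_ [[p [M [Pp PM Mf]]] _] _ _] _ _] := hD.
have M0 : M *m N j = 0.
  apply/row_matrixP => i; rewrite row0 row_mul; apply/matrixP => a b.
  have := tight _ (PM i); rewrite pairingDl (tight _ Pp) => /eqP.
  rewrite -[X in _ == X]addr0 (inj_eq (addrI _)) => /eqP.
  by rewrite /pairing !ord1 => ->; rewrite mxE.
have /eqP := conormal_neq0 j; apply.
have Mu : M \in unitmx by rewrite -row_free_unit.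
by rewrite -(mulKmx Mu (N j)) M0 mulmx0.
Qed.

(** * Polytopes in the chamber *)

Section chamber_points.
Variable k : 'rV[R]_m.
Hypothesis kC : chamber N k0 k.

(** This transfers faces from [k0] to [k]. For empty [J] a point of the polyhedron at [k] comes from
    a nonempty facet, whence the assumption [0 < m]. *)
Lemma chamber_face (J : {set 'I_m}) x : polyhedron N k0 x -> (0 < m)%N ->
  (forall j, j \in J -> pairing x (N j) = k0 0 j) ->
  exists2 y, polyhedron N k y & forall j, j \in J -> pairing y (N j) = k 0 j.
Proof.
move=> Px m0 xJ; have /chamberP h := kC.
have [J0|[i iJ]] := set_0Vmem J.
  have [z hz] := facet0_neq0 (Ordinal m0).
  have [|y hy] := (h [set Ordinal m0]%SET).1.
    by exists z => j; rewrite inE => /eqP ->.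
  exists y; first by have [] := hy (Ordinal m0) (set11 _).
  by move=> j; rewrite J0 inE.
have [y hy] := (h J).1 (ex_intro _ x (fun j jJ => conj Px (xJ j jJ))).
exists y; first by have [] := hy _ iJ.
by move=> j /hy[].
Qed.

(** Let [x] minimise the pairing with [N j] at [k0], and let [J] be the support of its dual
    certificate. A point of the face [J] at [k] is not on facet [j]: otherwise the face [j |: J]
    would be nonempty at [k0], although the pairing with [N j] is there the minimum, which is less
    than [k0 0 j]. *)
Lemma chamber_interior : exists x, forall j, pairing x (N j) < k 0 j.
Proof.
have key j : exists2 y, polyhedron N k y & pairing y (N j) < k 0 j.
  have m0 : (0 < m)%N by case: j => j; exact: leq_trans.
  have [x [a [Px a0 at_ uE]]] := conormal_cone (- N j).
  have val y : polyhedron N k0 y -> - pairing y (N j) <= - pairing x (N j).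
    move=> Py; rewrite -!pairingNr uE !pairing_sumr; apply: ler_sum => i _.
    rewrite !pairingZr; have [->|ai] := eqVneq (a i) 0; first by rewrite !mul0r.
    by rewrite (at_ _ ai) ler_wpM2l.
  have xj : pairing x (N j) < k0 0 j.
    have [y Py yj] := not_sub_facet0 j; apply: le_lt_trans yj.
    by rewrite -lerN2 val.
  pose J := [set i | a i != 0]%SET.
  have [y Py yJ] : exists2 y, polyhedron N k y &
      forall j, j \in J -> pairing y (N j) = k 0 j.
    by apply: (chamber_face Px m0) => i; rewrite inE => /at_.
  exists y => //; rewrite lt_neqAle Py andbT; apply/eqP => yj.
  have /chamberP h := kC.
  have [z hz] : exists z, face k0 (j |: J) z.
    apply/h; exists y => i; rewrite !inE => /orP[/eqP ->//|ai].
    by split=> //; apply: yJ; rewrite inE.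
  have [Pz zj] := hz j (setU11 _ _).
  have : - pairing z (N j) = - pairing x (N j).
    rewrite -!pairingNr uE !pairing_sumr; apply: eq_bigr => i _.
    rewrite !pairingZr; have [->|ai] := eqVneq (a i) 0; first by rewrite !mul0r.
    have [_] : facet N k0 i z by apply: hz; rewrite !inE ai orbT.
    by rewrite /hyperplane /= (at_ _ ai) => ->.
  by rewrite zj => /oppr_inj e; rewrite e ltxx in xj.
have /choice[y hy] j : exists y, polyhedron N k y /\ pairing y (N j) < k 0 j.
  by have [y] := key j; exists y.
(* At the average of the [y j], constraint [i] is strict thanks to [y i]. *)
exists (m%:R^-1 *: \sum_j y j) => i.
have m0 : (0 < m)%N by case: i => i; exact: leq_trans.
rewrite pairingZl mulrC ltr_pdivrMr ?ltr0n// pairing_suml.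
rewrite mulr_natr -[X in _ *+ X]card_ord -sumr_const.
rewrite (bigD1 i)//= [ltRHS](bigD1 i)//= ltr_leD//; first exact: (hy i).2.
by apply: ler_sum => j _; exact: (hy j).1.
Qed.

(** For [s < 0] the two constraints force each other to be tight, against [chamber_interior]; for
    [s > 0] the facets [i] and [j] coincide at [k0], against injectivity. *)
Lemma chamber_distinct i j : i != j ->
  ~ exists s, (forall l, coefs N i l = s * coefs N j l) /\ k 0 i = s * k 0 j.
Proof.
move=> ij [s [hs sk]].
have Nij : N i = s *: N j.
  by apply/matrixP => a b; rewrite ord1 mxE; exact: hs.
have [s0|s0|s0] := ltgtP s 0.
- have [x hx] := chamber_interior; have := hx i; have := hx j.
  by rewrite Nij pairingZr sk ltr_nM2l// => /ltW; rewrite leNgt => /negbTE ->.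
- have [[_ _ _ inj] _ _] := hD.
  have [x [Px xi]] := facet0_neq0 i; have [y [Py yj]] := facet0_neq0 j.
  have k0E : k0 0 i = s * k0 0 j.
    apply/eqP; rewrite eq_le; apply/andP; split.
      by rewrite -xi Nij pairingZr ler_pM2l.
    by rewrite -yj -pairingZr -Nij.
  move/eqP: ij; apply; apply: inj; apply/seteqP; split=> z [Pz zE]; split=> //;
    move: zE; rewrite /hyperplane /= Nij pairingZr k0E.
    by move/mulfI; apply; rewrite gt_eqF.
  by move=> ->.
- by have := conormal_neq0 i; rewrite Nij s0 scale0r eqxx.
Qed.

End chamber_points.

(* Let [u] be the sum of the conormals in [J] and [a] a dual certificate for [u].
   As [a] bounds [<., u>] on all polytopes of the chamber, with equality on a face
   common to all, if the face [J] is nonempty at the convex combination, then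
   both bounds [sum_j a_j k_j <= sum_(j in J) k_j], at [k] and [k'], are
   equalities, and the face [J] is nonempty at [k]. *)
Lemma chamber_convex k k' t : chamber N k0 k -> chamber N k0 k' -> 0 < t < 1 ->
  chamber N k0 (t *: k + (1 - t) *: k').
Proof.
move=> kC k'C /andP[t0 t1]; set k2 := _ + _.
have t1' : 0 < 1 - t by rewrite subr_gt0.
have k2E j : k2 0 j = t * k 0 j + (1 - t) * k' 0 j by rewrite !mxE.
have /chamberP h := kC; have /chamberP h' := k'C.
apply/chamberP => J; split.
  move=> [x0 hx0]; have [x hx] := (h J).1 (ex_intro _ x0 hx0).
  have [x' hx'] := (h' J).1 (ex_intro _ x0 hx0).
  exists (t *: x + (1 - t) *: x') => j jJ.
  have [Px xj] := hx _ jJ; have [Px' xj'] := hx' _ jJ.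
  split=> [l|]; rewrite ?/hyperplane/= pairingDl !pairingZl k2E.
    by apply: lerD; rewrite ler_pM2l.
  by rewrite xj xj'.
move=> [y hy]; apply/(h J).
have [J0|[i0 i0J]] := set_0Vmem J.
  by exists 0 => j; rewrite J0 inE.
have m0 : (0 < m)%N by case: i0 {i0J} => i; exact: leq_trans.
pose u := \sum_(j in J) N j.
have [x0 [a [Px0 a0 at_ uE]]] := conormal_cone u.
pose A := [set j | a j != 0]%SET.
have A0 j : j \in A -> pairing x0 (N j) = k0 0 j by rewrite inE => /at_.
have bound k1 : chamber N k0 k1 -> exists x, [/\ polyhedron N k1 x,
    pairing x u = \sum_j a j * k1 0 j & pairing x u <= \sum_(j in J) k1 0 j].
  move=> k1C; have [x Px xA] := chamber_face k1C Px0 m0 A0.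
  exists x; split=> //; last first.
    by rewrite /u pairing_sumr; apply: ler_sum => j _.
  rewrite uE pairing_sumr; apply: eq_bigr => j _; rewrite pairingZr.
  by have [->|aj] := eqVneq (a j) 0; rewrite ?mul0r// xA// inE.
have [x [Px xu xle]] := bound _ kC; have [x' [Px' xu' xle']] := bound _ k'C.
have Py : polyhedron N k2 y by have [] := hy _ i0J.
have yu : \sum_(j in J) k2 0 j <= \sum_j a j * k2 0 j.
  apply: (@le_trans _ _ (pairing y u)).
    by rewrite /u pairing_sumr; apply: ler_sum => j /hy[_ ->].
  rewrite uE pairing_sumr; apply: ler_sum => j _; rewrite pairingZr.
  by rewrite ler_wpM2l.
have S1 : \sum_(j in J) k2 0 j =
    t * (\sum_(j in J) k 0 j) + (1 - t) * (\sum_(j in J) k' 0 j).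
  by rewrite !mulr_sumr -big_split; apply: eq_bigr => j _; rewrite k2E.
have S2 : \sum_j a j * k2 0 j = t * pairing x u + (1 - t) * pairing x' u.
  rewrite xu xu' !mulr_sumr -big_split; apply: eq_bigr => j _.
  by rewrite k2E /=; ring.
have xe : \sum_(j in J) k 0 j <= pairing x u.
  rewrite -(ler_pM2l t0).
  have : (1 - t) * pairing x' u <= (1 - t) * (\sum_(j in J) k' 0 j).
    by rewrite ler_pM2l.
  by rewrite S1 S2 in yu; lra.
exists x => j jJ; split=> //; rewrite /hyperplane /=.
apply/eqP; rewrite eq_le Px /=.
move: xe; rewrite /u pairing_sumr (bigD1 j)//= [leRHS](bigD1 j)//=.
have : \sum_(i in J | i != j) pairing x (N i) <= \sum_(i in J | i != j) k 0 i.
  by apply: ler_sum => i _.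
by lra.
Qed.

(** The change of the levels when the polytope is translated by [v]. *)
Definition translation v : 'rV[R]_m := \row_j pairing v (N j).

Let face_affine k J s v x : 0 < s -> face k J x ->
  face (s *: k + translation v) J (s *: x + v).
Proof.
move=> s0 h j jJ; have [Px xj] := h _ jJ.
split=> [l|]; rewrite ?/hyperplane/= pairingDl pairingZl !mxE.
  by rewrite lerD2r ler_pM2l.
by rewrite xj.
Qed.

Lemma chamber_affine k s v : 0 < s -> chamber N k0 k ->
  chamber N k0 (s *: k + translation v).
Proof.
move=> s0 /chamberP h; apply/chamberP => J; rewrite h; split=> -[x hx].
  by exists (s *: x + v); exact: face_affine.
exists (s^-1 *: x + - (s^-1 *: v)).
have -> : k = s^-1 *: (s *: k + translation v) + translation (- (s^-1 *: v)).
  apply/rowP => j; rewrite !mxE pairingNl pairingZl mulrDr mulKf ?gt_eqF//.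
  by rewrite addrK.
by apply: face_affine; rewrite ?invr_gt0.
Qed.

End delzant_polytope.

(** * Homogeneous functions on a convex cone *)

Section real_derivatives.
Context {R : realType}.
Implicit Types phi : R -> R.

Lemma is_derive_shift phi x l :
  is_derive (0 : R) 1 (fun h : R => phi (x + h)) l -> is_derive x 1 phi l.
Proof.
have E : (fun h : R => h^-1 *: ((phi \o shift x) (h *: 1) - phi x)) =
    (fun h : R => h^-1 *:
      (((fun h : R => phi (x + h)) \o shift 0) (h *: 1) - phi (x + 0))).
  by apply/funext => h /=; rewrite !addr0 [x + _]addrC.
move=> [dphi vphi]; split.
  by move: dphi; rewrite /derivable E.
by rewrite -vphi /derive E.
Qed.

(** Both slopes equal the derivative, read off along sequences tending to 0 from the right and from
    the left. *)
Lemma derivable_one_sided phi (A B d : R) : 0 < d -> derivable phi 0 1 ->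
  phi 0 = 0 -> (forall h, 0 < h < d -> phi h = h * A) ->
  (forall h, - d < h < 0 -> phi h = h * B) -> A = B.
Proof.
move=> d0 /cvg_ex[l /cvgr_dnbhsP hl] p0 pA pB.
(* The factor [d / 2] keeps the sequence strictly below [d], since the harmonic sequence starts at
   1. *)
have u0 : (d / 2 * harmonic n)%R @[n --> \oo] --> (0 : R).
  by rewrite -(mulr0 (d / 2)); apply: cvgMr; exact: cvg_harmonic.
have pos n : 0 < d / 2 * harmonic n by rewrite mulr_gt0 ?divr_gt0 ?harmonic_gt0.
have small n : d / 2 * harmonic n < d.
  apply: (@le_lt_trans _ _ (d / 2)); last by lra.
  by apply: ler_piMr; [rewrite divr_ge0 ?ltW|rewrite /harmonic/= invf_le1 ?ltr0n ?ler1n].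
have lim C (s : R) : s != 0 -> (forall n, phi (s * (d / 2 * harmonic n)) =
    s * (d / 2 * harmonic n) * C) -> l = C.
  move=> s0 hC; have un : (s * (d / 2 * harmonic n))%R @[n --> \oo] --> (0 : R).
    by rewrite -(mulr0 s); exact: cvgMr.
  have nz n : s * (d / 2 * harmonic n) != 0 by rewrite mulf_neq0// gt_eqF.
  have := hl _ (conj nz un); set v := (X in X @ _ --> _).
  have -> : v = cst C.
    apply/funext => n; rewrite /v /= p0 subr0 addr0 [_ *: 1]mulr1 hC.
    exact: (mulKf (nz n) C).
  by move=> h; apply: (cvg_unique _ h (@cvg_cst _ _ _ _ _)).
rewrite -(lim A 1) ?oner_neq0//; last by move=> n; rewrite mul1r pA// pos small.
apply: (lim B (-1)); first by rewrite oppr_eq0 oner_neq0.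
by move=> n; rewrite mulN1r pB// oppr_lt0 ltrN2 pos small.
Qed.

Lemma is_derive_pairing n (M : R -> 'rV[R]_n) (c : 'cV[R]_n) t :
  derivable M t 1 ->
  is_derive t 1 (fun x => pairing (M x) c) (pairing ('D_1 M t) c).
Proof.
move=> dM.
have h : (fun h : R => h^-1 *:
    (((fun x => pairing (M x) c) \o shift t) (h *: 1) - pairing (M t) c)) @ 0^'
    --> pairing ('D_1 M t) c.
  rewrite (_ : (fun h : R => _) = (fun x => pairing x c) \o
    (fun h : R => h^-1 *: ((M \o shift t) (h *: 1) - M t))); last first.
    by apply/funext => h /=; rewrite pairingZl pairingBl.
  exact: (cvg_comp _ _ (dM : _ --> 'D_1 M t) (@pairing_continuous _ _ c _)).
split; first by apply/cvg_ex; eexists; exact: h.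
exact: cvg_lim h.
Qed.

Lemma is_derive_affine (a b : R) : is_derive (0 : R) 1 (fun h : R => a + h * b : R) b.
Proof.
have h : (fun h : R => h^-1 *:
    (((fun x : R => a + x * b) \o shift 0) (h *: 1) - (a + 0 * b))) @ 0^' --> b.
  apply: cvg_near_cst; near=> h.
  rewrite /= addr0 [h *: 1]mulr1 /GRing.scale /= mul0r addr0 addrAC subrr add0r.
  by rewrite mulKf//; near: h; exact: nbhs_dnbhs_neq.
split; first by apply/cvg_ex; eexists; exact: h.
exact: cvg_lim h.
Unshelve. all: by end_near. Qed.

End real_derivatives.

Section homogeneous.
Context {R : realType} {n m : nat}.
Variables (A : 'M[R]_(n, m)) (e : 'rV[R]_m) (Ch : set 'rV[R]_m).
Variables (f : 'rV[R]_m -> R) (c : 'cV[R]_n) (kappa : R).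
Hypothesis free : row_free (col_mx A e).
Hypothesis mn : (m <= n.+2)%N.
Hypothesis convex : forall k k' t, Ch k -> Ch k' -> 0 < t < 1 ->
  Ch (t *: k + (1 - t) *: k').
Hypothesis Ch_affine : forall k s v, 0 < s -> Ch k -> Ch (s *: k + v *m A).
Hypothesis f_affine : forall k s v, 0 < s -> Ch k ->
  f (s *: k + v *m A) = s * f k + pairing v c.
Hypothesis f_derivable : forall k d, Ch k ->
  derivable (fun h : R => f (k + h *: d) : R) 0 1.
Hypothesis f_e : forall k, Ch k -> 'D_1 (fun h : R => f (k + h *: e) : R) 0 = kappa.

Lemma homogeneous_linear : exists L : 'cV[R]_m, forall k, Ch k -> f k = pairing k L.
Proof.
(* A right inverse of [col_mx A e] gives a linear form with prescribed values on the translations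
   and on [e]. *)
have [L AL eL] : exists2 L : 'cV[R]_m, A *m L = c & pairing e L = kappa.
  have /row_freeP[B hB] := free.
  exists (B *m col_mx c kappa%:M).
    have := congr1 (fun M => usubmx (M *m col_mx c kappa%:M)) hB.
    by rewrite mul1mx col_mxKu -mulmxA mul_col_mx col_mxKu.
  have := congr1 (fun M => dsubmx (M *m col_mx c kappa%:M)) hB.
  rewrite mul1mx col_mxKd -mulmxA mul_col_mx col_mxKd /pairing => ->.
  by rewrite mxE mulr1n.
(* The row space has dimension n + 1 >= m - 1, so its cokernel has rank at most 1. In rank 0 it is
   the whole space and [l = 0] does. *)
have [l lP] : exists l : 'cV[R]_m, forall w : 'rV_m, pairing w l = 0 ->
    (w <= col_mx A e)%MS.
  have pz (w : 'rV[R]_m) (l : 'cV[R]_m) : pairing w l = 0 -> w *m l = 0.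
    by move=> h; apply/matrixP => i j; rewrite !ord1 [RHS]mxE.
  have rK : (\rank (cokermx (col_mx A e)) <= 1)%N.
    rewrite mxrank_coker; move/eqP: free => ->.
    by rewrite leq_subLR addn1 addn1.
  have := mulmx_base (cokermx (col_mx A e)).
  move: (col_base _) (row_base _); case: (\rank _) rK => [|[|//]] _ C B CB.
    exists 0 => w _; rewrite submxE -CB.
    by rewrite [C]thinmx0 mul0mx mulmx0.
  by exists C => w /pz wC; rewrite submxE -CB mulmxA wC mul0mx.
pose g k := f k - pairing k L.
have g_affine k s v : 0 < s -> Ch k -> g (s *: k + v *m A) = s * g k.
  move=> s0 kC; rewrite /g f_affine// pairingDl pairingZl.
  have -> : pairing (v *m A) L = pairing v c by rewrite /pairing -mulmxA AL.
  by ring.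
have g_derive k d : Ch k -> derivable (fun h : R => g (k + h *: d) : R) 0 1 /\
    'D_1 (fun h : R => g (k + h *: d) : R) 0 =
    'D_1 (fun h : R => f (k + h *: d) : R) 0 - pairing d L.
  move=> kC.
  have lin : is_derive (0 : R) 1 (fun h : R => pairing (k + h *: d) L : R) (pairing d L).
    rewrite (_ : (fun h : R => _) = fun h : R => pairing k L + h * pairing d L : R).
      exact: is_derive_affine.
    by apply/funext => h; rewrite pairingDl pairingZl.
  have df := @f_derivable k d kC.
  rewrite (_ : (fun h : R => g _) = (fun h : R => f (k + h *: d) : R) -
     (fun h : R => pairing (k + h *: d) L : R)); last exact/funext.
  split; first by apply: derivableB.
  by rewrite deriveB// derive_val.
(* By convexity the segment stays in [Ch]; the derivative of [g] along it is 0, and the mean value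
   theorem applies. *)
have g_e k T : 0 < T -> Ch k -> Ch (k + T *: e) -> g (k + T *: e) = g k.
  move=> T0 kC kTC.
  have seg x : 0 <= x <= T -> Ch (k + x *: e).
    move=> /andP[]; rewrite le_eqVlt => /orP[/eqP <- _|x0].
      by rewrite scale0r addr0.
    rewrite le_eqVlt => /orP[/eqP -> //|xT].
    have -> : k + x *: e = (x / T) *: (k + T *: e) + (1 - x / T) *: k.
      rewrite scalerDr scalerA divfK ?gt_eqF// addrAC -scalerDl.
      have -> : x / T + (1 - x / T) = 1 by ring.
      by rewrite scale1r.
    by apply: convex => //; rewrite divr_gt0//= ltr_pdivrMr// mul1r.
  pose phi x : R := g (k + x *: e).
  have dphi x : 0 <= x <= T -> is_derive x 1 phi 0.
    move=> /seg xC; apply: is_derive_shift.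
    have [dg vg] := g_derive _ e xC.
    rewrite (_ : (fun h : R => _) = fun h : R => g (k + x *: e + h *: e)); last first.
      by apply/funext => h; rewrite /phi scalerDl addrA.
    by split=> //; rewrite vg f_e// eL subrr.
  have [||z _] := @MVT_segment R phi (fun=> 0) 0 T (ltW T0).
  - by move=> x; rewrite in_itv/= => /andP[x0 xT]; apply: dphi; rewrite !ltW.
  - apply: derivable_within_continuous => x; rewrite in_itv/= => xT.
    by have [] := dphi x xT.
  by rewrite mul0r /phi scale0r addr0 => /eqP; rewrite subr_eq0 => /eqP.
(* The translation is performed first, because it never leaves [Ch]; then both ends of the move
   along [e] lie in [Ch]. For [s < 0] that move is read backwards. *)
have g_W k w : Ch k -> Ch (k + w) -> pairing w l = 0 -> g (k + w) = g k.
  move=> kC kwC /lP /submxP[z]; rewrite -[z]hsubmxK mul_row_col => wE.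
  set v := lsubmx z in wE; set s := rsubmx z 0 0.
  have {}wE : w = v *m A + s *: e.
    by rewrite wE [rsubmx z]mx11_scalar mul_scalar_mx.
  pose k' := 1 *: k + v *m A.
  have k'C : Ch k' by apply: Ch_affine.
  have gk' : g k' = g k by rewrite g_affine// mul1r.
  have kwE : k + w = k' + s *: e by rewrite /k' scale1r wE addrA.
  rewrite kwE -gk'; rewrite kwE in kwC.
  have [s0|s0|->] := ltgtP s 0; last by rewrite scale0r addr0.
    rewrite -[in RHS](addrK (s *: e) k') -scaleNr.
    by symmetry; apply: g_e; rewrite ?oppr_gt0// scaleNr addrK.
  exact: g_e.
have scale k s : 0 < s -> Ch k -> Ch (s *: k) /\ g (s *: k) = s * g k.
  move=> s0 kC; have := @Ch_affine k s 0 s0 kC; have := g_affine k s 0 s0 kC.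
  by rewrite mul0mx addr0.
(* [g (2 *: k)] is [2 * g k] by homogeneity, and [g k] because [k] itself is in the kernel of
   [l]. *)
have g_zero k : Ch k -> pairing k l = 0 -> g k = 0.
  move=> kC lk; have [C2 g2] := scale k 2 (ltr0n _ _) kC.
  have kk : 2 *: k = k + k by rewrite scaler_nat mulr2n.
  have := g_W k k kC; rewrite -kk => /(_ C2 lk); rewrite g2; lra.
have g_pos k k1 s : Ch k -> Ch k1 -> 0 < s -> pairing k l = s * pairing k1 l ->
    g k = s * g k1.
  move=> kC k1C s0 ls; have [sC <-] := scale k1 s s0 k1C.
  rewrite -[k in LHS](subrK (s *: k1)) addrC; apply: g_W => //.
    by rewrite addrC subrK.
  by rewrite pairingBl pairingZl ls subrr.
(* The segment from [k1] to [k] meets the kernel of [l] at [ks], where [g] vanishes. Along [d] the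
   function is linear on either side of [ks], and differentiability makes the two slopes agree. *)
have g_neg k k1 : Ch k -> Ch k1 -> pairing k l < 0 -> 0 < pairing k1 l ->
    g k / pairing k l = g k1 / pairing k1 l.
  move=> kC k1C; set q := pairing k l; set p := pairing k1 l => q0 p0.
  pose th := p / (p - q).
  have pq : 0 < p - q by lra.
  have th0 : 0 < th by rewrite divr_gt0.
  have th1 : th < 1 by rewrite ltr_pdivrMr// mul1r; lra.
  pose ks := th *: k + (1 - th) *: k1.
  have ksC : Ch ks by apply: convex; rewrite ?th0.
  have lks : pairing ks l = 0.
    by rewrite /ks pairingDl !pairingZl -/p -/q /th; field; rewrite gt_eqF.
  pose d := k - k1.
  have ksh h : ks + h *: d = (th + h) *: k + (1 - (th + h)) *: k1.
    by rewrite /ks /d; apply/rowP => j; rewrite !mxE; ring.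
  have lksh h : pairing (ks + h *: d) l = h * (q - p).
    by rewrite pairingDl lks add0r pairingZl pairingBl.
  have [dg _] := g_derive ks d ksC.
  have dpos : 0 < Num.min th (1 - th) by rewrite lt_min th0 subr_gt0.
  have := @derivable_one_sided _ _ ((q - p) / q * g k) ((q - p) / p * g k1) _ dpos dg.
  rewrite scale0r addr0 g_zero// => /(_ erefl) h.
  have : (q - p) / q * g k = (q - p) / p * g k1.
    apply: h => h /andP[].
      move=> h0; rewrite lt_min => /andP[hth h1].
      have kC' : Ch (ks + h *: d).
        by rewrite ksh; apply: convex => //; apply/andP; split; lra.
      rewrite mulrA; apply: g_pos => //.
        apply: mulr_gt0 => //; rewrite nmulr_rgt0 ?invr_lt0//; lra.
      by rewrite lksh -/q; field; rewrite lt_eqF.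
    rewrite ltrNl lt_min => /andP[hth h1] h0.
    have kC' : Ch (ks + h *: d).
      by rewrite ksh; apply: convex => //; apply/andP; split; lra.
    rewrite mulrA; apply: g_pos => //.
      rewrite mulrA; apply: divr_gt0 => //; rewrite nmulr_rgt0//; lra.
    by rewrite lksh -/p; field; rewrite gt_eqF.
  have qp : q - p != 0 by rewrite subr_eq0 lt_eqF// (lt_trans q0).
  rewrite -!mulrA => /(mulfI qp); rewrite mulrC => ->; by rewrite mulrC.
(* If [l] vanishes on [Ch], so does [g], and [L] works; otherwise [l] times the common slope is
   added to [L]. *)
have [[k1 k1C l1]|none] := pselect (exists2 k, Ch k & pairing k l != 0); last first.
  exists L => k kC; apply/eqP; rewrite -subr_eq0; apply/eqP; apply: g_zero => //.
  by apply/eqP; apply: contra_notT none => lk; exists k.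
exists (L + (g k1 / pairing k1 l) *: l) => k kC.
rewrite /pairing mulmxDr mxE -/(pairing k L) -/(pairing k _) pairingZr.
rewrite -[LHS](subrK (pairing k L)) addrC; congr (_ + _); rewrite -/(g k).
have [lk|lk] := eqVneq (pairing k l) 0; first by rewrite lk mulr0 g_zero.
suff <- : g k / pairing k l = g k1 / pairing k1 l by rewrite divfK.
have [s0|s0] := ltP 0 (pairing k l / pairing k1 l).
  rewrite (g_pos k k1 _ kC k1C s0); last by rewrite divfK.
  by field; rewrite lk l1.
have [k_gt|k_lt|k_eq] := ltgtP 0 (pairing k l); last by rewrite -k_eq eqxx in lk.
  have k1_lt : pairing k1 l < 0.
    by rewrite lt_neqAle l1 leNgt; apply: contraTN s0 => ?; rewrite -ltNge divr_gt0.
  by rewrite (g_neg k1 k).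
have k1_gt : 0 < pairing k1 l.
  rewrite lt_neqAle eq_sym l1 leNgt; apply: contraTN s0 => ?.
  by rewrite -ltNge nmulr_rgt0// invr_lt0.
exact: g_neg.
Qed.

End homogeneous.

(** * Mass linearity *)

Section center_of_mass_theory.
Context {R : realType} {n m : nat} (N : 'I_m -> 'cV[R]_n) (k0 : 'rV[R]_m).
Hypothesis hD : delzant N k0.

Let coefs_neq0 j : exists l, coefs N j l != 0.
Proof.
apply: contrapT => h; move/eqP: (conormal_neq0 hD j); apply.
apply/matrixP => a b; rewrite ord1 [RHS]mxE; apply/eqP.
by apply: contra_notT h => Na; exists a.
Qed.

Let coefs_bounded k' : exists B : R, forall t, hpoly (coefs N) k' t ->
  forall i, `|tnth t i| <= B.
Proof.
have [B hB] := polyhedron_bounded hD (\row_j k' j).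
exists B => t ht i; have := hB (\row_i tnth t i) _ i; rewrite mxE; apply.
by apply/polyhedron_hpoly => j; rewrite mxE; exact: ht.
Qed.

Let vol_neq0 k : chamber N k0 k -> vol (coefs N) (fun j => k 0 j) != 0.
Proof.
move=> kC; rewrite gt_eqF//; apply: vol_gt0; last exact: coefs_bounded.
have [x hx] := chamber_interior hD kC; exists (x 0) => j.
by have := hx j; rewrite pairingE; under eq_bigr do rewrite mulrC.
Qed.

Lemma Cm_derivable k d : chamber N k0 k ->
  derivable (fun h : R => Cm N (k + h *: d)) 0 1.
Proof.
move=> kC; apply/derivable_mxP => i0 i; rewrite ord1.
rewrite (_ : (fun h : R => _) = fun h : R =>
    com (coefs N) (fun j => k 0 j + h * d 0 j) i).
  apply: com_derivable => //; last exact: vol_neq0.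
  by move=> j l jl; exact: (chamber_distinct hD kC).
by apply/funext => h; rewrite CmE; congr com; apply/funext => j; rewrite !mxE.
Qed.

Lemma Cm_affine k s v : chamber N k0 k -> 0 < s ->
  Cm N (s *: k + translation N v) = s *: Cm N k + v.
Proof.
move=> kC s0; apply/rowP => i; rewrite CmE [RHS]mxE [X in _ = X + _]mxE CmE.
have := com_affine coefs_bounded (v 0) i (vol_neq0 kC) s0 => <-.
congr com; apply/funext => j; rewrite !mxE pairingE.
by congr (_ + _); apply: eq_bigr => l _; rewrite mulrC.
Qed.

End center_of_mass_theory.

(** In a linear relation [v] pairs with all conormals to the same number, so [v] or [- v] is a
    recession direction and [v = 0]; then [s = 0], since there is at least one conormal. *)
Lemma delzant_row_free (R : realType) (n m : nat)
    (N : 'I_m -> 'cV[R]_n) (k0 : 'rV[R]_m) :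
  delzant N k0 -> (0 < n)%N ->
  row_free (col_mx (\matrix_(i, j) N j i 0) (const_mx 1 : 'rV[R]_m)).
Proof.
move=> hD n0.
rewrite -kermx_eq0; apply/rowV0P => w /sub_kermxP.
rewrite -[w]hsubmxK mul_row_col; move: (lsubmx w) (rsubmx w) => v s ws.
have vs j : pairing v (N j) + s 0 0 = 0.
  have /matrixP/(_ 0 j) := ws; rewrite [RHS]mxE => e; apply: etrans e.
  rewrite [RHS]mxE pairingE; congr (_ + _).
    by rewrite [RHS]mxE; apply: eq_bigr => i _; rewrite mxE.
  by rewrite {2}[s]mx11_scalar mul_scalar_mx !mxE mulr1.
(* As [n] is positive, a standard basis vector is a combination of conormals; being nonzero, it
   needs at least one of them. *)
have [j0 _] : exists j : 'I_m, True.
  have [_ [a [_ _ _ uE]]] := conormal_cone hD (delta_mx (Ordinal n0) 0).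
  case: m N k0 hD a uE {ws vs v s w} => [N0 k1 h a uE|m' *]; last by exists ord0.
  have /matrixP/(_ (Ordinal n0) 0)/eqP := uE.
  by rewrite big_ord0 !mxE !eqxx oner_eq0.
have v0 : v = 0.
  have [s0|/ltW s0] := leP 0 (s 0 0).
    by apply: (recession_cone0 hD) => j; have := vs j; lra.
  apply/oppr_inj; rewrite oppr0; apply: (recession_cone0 hD) => j.
  by rewrite pairingNl; have := vs j; lra.
have s0 : s = 0.
  apply/matrixP => a b; have := vs j0; rewrite v0 !ord1 pairingE big1 ?add0r.
    by move=> ->; rewrite mxE.
  by move=> i _; rewrite mxE mul0r.
by rewrite v0 s0 row_mx0.
Qed.

Theorem proposition11 (R : realType) (n m : nat)
    (N : 'I_m -> 'cV[R]_n) (k0 : 'rV[R]_m)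
    (hDelzant : delzant N k0)
    (hCm : exists2 c : 'cV[int]_n, c != 0 &
       exists kappa : R, forall k : 'rV[R]_m, chamber N k0 k ->
         hyperplane (map_mx intr c) kappa (Cm_dot N k))
    (hr : (m - n <= 2)%N) :
  exists2 b : 'cV[R]_n, b != 0 & mass_linear N k0 b.
Proof.
have [c c0 [kappa hk]] := hCm.
pose b : 'cV[R]_n := map_mx intr c.
have b0 : b != 0.
  apply: contraNneq c0 => b0; apply/eqP/matrixP => i j; rewrite [RHS]mxE.
  by have /matrixP/(_ i j)/eqP := b0; rewrite !mxE intr_eq0 => /eqP.
exists b => //.
pose A : 'M[R]_(n, m) := \matrix_(i, j) N j i 0.
have AE v : v *m A = translation N v.
  by apply/rowP => j; rewrite !mxE pairingE; apply: eq_bigr => i _; rewrite mxE.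
have n0 : (0 < n)%N.
  by case: n c c0 {hk b b0 A AE N k0 hDelzant hCm hr} => [c|//]; rewrite [c]flatmx0 eqxx.
have [L hL] : exists L : 'cV_m, forall k, chamber N k0 k ->
    pairing (Cm N k) b = pairing k L.
  apply: (@homogeneous_linear R n m A (const_mx 1) (chamber N k0)
    (fun k => pairing (Cm N k) b) b kappa).
  - exact: delzant_row_free hDelzant n0.
  - by move: hr; rewrite leq_subLR addn2.
  - exact: chamber_convex.
  - by move=> k s v s0 kC; rewrite AE; exact: chamber_affine.
  - move=> k s v s0 kC; rewrite AE (Cm_affine hDelzant)//.
    by rewrite pairingDl pairingZl.
  - by move=> k d kC; have [] := is_derive_pairing b (@Cm_derivable _ _ _ _ _ hDelzant k d kC).
  - move=> k kC; have [_ ->] := is_derive_pairing b (@Cm_derivable _ _ _ _ _ hDelzant k (const_mx 1) kC).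
    rewrite -[RHS](hk k kC) /Cm_dot derive1E.
    rewrite (_ : (fun h : R => Cm N (k + h *: _)) =
      fun eps : R => Cm N (k + const_mx eps))//.
    apply/funext => h; congr (Cm N (k + _)).
    by apply/rowP => j; rewrite !mxE mulr1.
(* The constant term is 0, as [homogeneous_linear] yields a linear form. *)
exists (fun j => L j 0), 0 => k kC; rewrite addr0 hL// pairingE.
by apply: eq_bigr => j _; rewrite mulrC.
Qed.
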